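(* Let $S$ be a nonempty, closed, and convex subset of a Banach algebra $E$ satisfying condition $(\mathcal{P})$. Assume that $A, C : E \to \mathcal{P}_{cl,cv}(E)$ and $B : S \to \mathcal{P}_{cl,cv}(E)$ are three multi-valued mappings with weakly sequentially closed graphs such that: (i) $A$ is weakly compact; (ii) $B$ is a countably $\mathcal{D}$-set-contraction with $\mathcal{D}$-function $\Phi$; (iii) $C$ is a $\mathcal{D}$-set-contraction with $\mathcal{D}$-function $\Psi$; (iv) $A(E)$, $B(S)$ and $C(E)$ are bounded; (v) for each $u\in S$, $\left(\frac{I-C}{A}\right)^{-1}B(u)$ is a closed, convex subset of $S$. Then the operator inclusion $x\in A(x)\cdot B(x)+C(x)$ has a solution in $S$ whenever $\|A(S)\|\,\Phi(r)+\Psi(r)< r$ for all $r>0$.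
   Context: $\mathcal{P}(E)$ (resp. $\mathcal{P}_{cl,cv}(E)$) is the family of all nonempty (resp. nonempty closed convex) subsets of $E$. For a multi-valued $F$ and a subset $M$ of its domain, $F(M)=\bigcup_{x\in M}F(x)$. For $M\subset E$, $\|M\|=\sup\{\|x\|:x\in M\}$. Products and sums of sets are taken elementwise. $\rightharpoonup$ denotes weak convergence. Condition $(\mathcal P)$ for a Banach algebra $E$: whenever $\alpha_n\rightharpoonup\alpha$ and $\beta_n\rightharpoonup\beta$ in $E$, then $\alpha_n\cdot\beta_n\rightharpoonup\alpha\cdot\beta$. Write $y\in\left(\frac{I-C}{A}\right)(x)$ if $x\in A(x)\cdot y+C(x)$. For $M\subset E$, $\left(\frac{I-C}{A}\right)^{-1}(M)=\{x\in E: \left(\frac{I-C}{A}\right)(x)\cap M\ne\emptyset\}$, so $\left(\frac{I-C}{A}\right)^{-1}B(u)=\{x\in E:\ \exists y\in B(u),\ x\in A(x)\cdot y+C(x)\}$. For $F:D\to\mathcal P(E)$, $D\subset E$: $F$ has a weakly sequentially closed graph if whenever $x_n\in D$, $x_n\rightharpoonup x\in D$, $y_n\in F(x_n)$ and $y_n\rightharpoonup y$ in $E$, then $y\in F(x)$. $F$ is weakly compact if $F(M)$ is relatively weakly compact for every bounded $M\subset D$. $\beta$ is the De Blasi measure of weak noncompactness: for bounded $W\subset E$, $\beta(W)=\inf\{\varepsilon>0:\ \exists K\subset E \text{ weakly compact},\ W\subset K+\mathcal{B}_E(\varepsilon)\}$, where $\mathcal{B}_E(\varepsilon)$ is the closed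 ball of radius $\varepsilon$ centred at the origin. $F$ is a $\mathcal{D}$-set-contraction (resp. countably $\mathcal D$-set-contraction) with $\mathcal D$-function $\varphi$ if $\varphi:\mathbb{R}_+\to\mathbb{R}_+$ is continuous, nondecreasing, $\varphi(0)=0$, $\varphi(r)<r$ for $r>0$, and $\beta(F(W))\le\varphi(\beta(W))$ for every bounded (resp. countable bounded) subset $W$ of $D$ with $F(W)$ bounded. *)

(* Defs.v *)
From HB Require Import structures.
From mathcomp Require Import all_boot all_order all_algebra.
From mathcomp Require Import all_classical all_reals all_analysis.
Import Order.TTheory GRing.Theory Num.Theory.
Import numFieldNormedType.Exports.

Set Implicit Arguments.
Unset Strict Implicit.
Unset Printing Implicit Defensive.

Local Open Scope classical_set_scope.
Local Open Scope ring_scope.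

(* The product is not required to have a unit, which rules out the (unital)
   ring structures of MathComp; hence the dedicated operation [bmul]. *)
HB.mixin Record CompleteNormedModule_isBanachAlgebra (K : numFieldType) E
    & CompleteNormedModule K E := {
  bmul : E -> E -> E;
  bmulA : forall x y z : E, bmul x (bmul y z) = bmul (bmul x y) z;
  bmulDl : forall x y z : E, bmul (x + y) z = bmul x z + bmul y z;
  bmulDr : forall x y z : E, bmul x (y + z) = bmul x y + bmul x z;
  bmulZl : forall (k : K) (x y : E), bmul (k *: x) y = k *: bmul x y;
  bmulZr : forall (k : K) (x y : E), bmul x (k *: y) = k *: bmul x y;
  normr_bmul : forall x y : E, `|bmul x y| <= `|x| * `|y|
}.

#[short(type="banachAlgType")]
HB.structure Definition BanachAlgebra (K : numFieldType) :=
  {E of CompleteNormedModule K E & CompleteNormedModule_isBanachAlgebra K E}.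

Section WeakTopology.
Context {R : realType} (E : normedModType R).

Definition dual := {f : {linear E -> R^o} | continuous f}.

(* The copy of [E] carrying the coarsest topology making every continuous
   linear functional continuous. *)
Definition weak : Type := E.

HB.instance Definition _ := Topological.copy weak (sup_topology
  (fun f : dual => Topological.on (initial_topology (sval f : E -> R^o)))).

Definition weak_cvg (x_ : nat -> E) (x : E) := x_ @ \oo --> (x : weak).

Definition weakly_compact (K : set E) := compact (K : set weak).

Definition relatively_weakly_compact (M : set E) := precompact (M : set weak).

End WeakTopology.

Section SetOperations.
Context {R : realType}.

Definition set_add (E : normedModType R) (M N : set E) : set E :=
  [set x + y | x in M & y in N].

Definition set_mul (E : banachAlgType R) (M N : set E) : set E :=
  [set bmul x y | x in M & y in N].

(* Meaningful for bounded nonempty [M]; [sup] is the real supremum. *)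
Definition set_norm (E : normedModType R) (M : set E) : R :=
  sup [set `|x| | x in M].

End SetOperations.

Section DeBlasi.
Context {R : realType} (E : normedModType R).

(* Only applied to bounded [W], for which the infimum ranges over a nonempty
   set. *)
Definition de_blasi (W : set E) : R :=
  inf [set e : R | 0 < e /\ exists K : set E,
    weakly_compact K /\ W `<=` set_add K (closed_ball 0 e)].

End DeBlasi.

(* A multi-valued mapping [D -> P(E)], [D] a subset of [E], is represented by a
   total [F : E -> set E] whose values outside [D] are never used. *)
Section MultiValued.
Context {R : realType} (E : normedModType R).
Implicit Types (D M W : set E) (F : E -> set E) (phi : R -> R).

Definition closed_convex_valued D F := forall x, D x ->
  [/\ F x !=set0, closed (F x) & convex_set (F x)].

Definition mimage F M : set E := \bigcup_(x in M) F x.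

Definition mpreimage F M : set E := [set x | F x `&` M !=set0].

Definition weakly_seq_closed_graph D F :=
  forall (x_ y_ : nat -> E) (x y : E),
    (forall n, D (x_ n)) -> weak_cvg x_ x -> D x ->
    (forall n, F (x_ n) (y_ n)) -> weak_cvg y_ y -> F x y.

Definition weakly_compact_map D F := forall M,
  M `<=` D -> bounded_set M -> relatively_weakly_compact (mimage F M).

(* [phi : R_+ -> R_+]; values at negative reals are irrelevant. *)
Definition D_function phi :=
  [/\ forall r, 0 <= r -> 0 <= phi r,
      {within `[0, +oo[%classic, continuous phi},
      forall r s, 0 <= r -> r <= s -> phi r <= phi s,
      phi 0 = 0
    & forall r, 0 < r -> phi r < r].

Definition D_set_contraction D F phi :=
  D_function phi /\
  forall W, W `<=` D -> bounded_set W -> bounded_set (mimage F W) ->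
    de_blasi (mimage F W) <= phi (de_blasi W).

Definition countably_D_set_contraction D F phi :=
  D_function phi /\
  forall W, W `<=` D -> countable W -> bounded_set W ->
    bounded_set (mimage F W) -> de_blasi (mimage F W) <= phi (de_blasi W).

End MultiValued.

Section BanachAlgebraNotions.
Context {R : realType} (E : banachAlgType R).

Definition condition_P := forall (a_ b_ : nat -> E) (a b : E),
  weak_cvg a_ a -> weak_cvg b_ b ->
  weak_cvg (fun n => bmul (a_ n) (b_ n)) (bmul a b).

(* The multi-valued mapping (I - C) / A. *)
Definition quotient_map (A C : E -> set E) (x : E) : set E :=
  [set y | set_add (set_mul (A x) [set y]) (C x) x].

End BanachAlgebraNotions.

(* Main.v *)
From HB Require Import structures.
Require Import Defs.
From mathcomp Require Import all_boot all_order all_algebra.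
From mathcomp Require Import all_classical all_reals all_analysis.
From mathcomp Require Import ring lra.
Import Order.TTheory GRing.Theory Num.Theory.
Import numFieldNormedType.Exports.
Set Implicit Arguments.
Unset Strict Implicit.
Unset Printing Implicit Defensive.
Local Open Scope classical_set_scope.
Local Open Scope ring_scope.

(* For [u] in [S] put [N u = ((I - C) / A)^-1 (B u)].  A fixed point of [N] solves the
   inclusion.  Values of [N] are nonempty because, for [y] in [B u], a fixed point of the
   condensing map [x |-> A x . y + C x] belongs to [N u].  Both fixed points come from one
   principle: if [f] is a selection of [F] with [beta (f D) < beta D] for countable
   bounded [D] with [beta D > 0], then the countable hull [D] of [x0] under [f] and
   convex combinations has [beta D <= beta (f D)], so its closure [K] is weakly compact;
   [K] is moreover separable, and a weak form of Kakutani's theorem applies on [K].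

   Separability replaces the Eberlein-Smulian theorem: countably many functionals
   separate the points of [K], so weak compactness yields weakly convergent subsequences.
   Krein's theorem, which makes [beta] invariant under convex hulls, is proved through
   barycenters of finitely additive means, and Kakutani's theorem through Sperner's
   lemma, proved modulo 2 on chains of simplices. *)

(** * Sublinear functionals *)

(** In [N] the maps [A] and [C] are evaluated at the unknown point, [B] at [u]. With [r] and [t] the
    measures of [D] and of [f D], this gives [t <= |A(S)| Phi(r) + Psi(t)], with [t] on both sides;
    were [r <= t], monotonicity of [Phi] would contradict the hypothesis at [t]. No term for the
    measure of [A(f D)] appears: the [A]-parts are relatively weakly compact, and by (P) so are
    their products with weakly compact approximants of the [B]-parts. For a fixed [y], compactness
    of the [A]-parts leaves only [Psi], and [Psi(r) < r] settles the inner fixed point.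

    Following a single selected value keeps the hull countable, as the hypothesis on [B] demands.
    The price is that [F] need not map [K] into itself: the closed graph only shows that each [F x]
    meets [K], and Kakutani's theorem is proved in that form.

    Condition (P) concerns sequences, whereas weak compactness is handled through ultrafilters; the
    passage is made by extracting, from an ultrafilter limit, sets of indices along which every
    choice converges. *)

Section HahnBanach.
Context {R : realType} {V : lmodType R}.
Implicit Types (p q g : V -> R) (G : V -> R -> Prop).

Definition sublinear p :=
  (forall x y, p (x + y) <= p x + p y) /\
  (forall t x, 0 <= t -> p (t *: x) = t * p x).

(** [G v r] encodes a demand [r <= g v] on an unknown functional [g]. A linear [g] that meets
    demands also meets their sums and nonnegative multiples, so nothing is lost by requiring a
    cone. *)
Definition convex_cone G :=
  [/\ G 0 0,
      forall v w r s, G v r -> G w s -> G (v + w) (r + s)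
    & forall t v r, 0 <= t -> G v r -> G (t *: v) (t * r)].

Lemma sublinear0 p : sublinear p -> p 0 = 0.
Proof. by move=> [_ pZ]; rewrite -(scale0r 0) pZ// mul0r. Qed.

Lemma sublinear_oppr p x : sublinear p -> - p (- x) <= p x.
Proof.
move=> ps; have := ps.1 x (- x); rewrite subrr (sublinear0 ps); lra.
Qed.

(* Its linear minorants are those of [p] that dominate [r] at [v] whenever [G v r]. *)
Definition cone_minorant p G x :=
  inf [set z | exists v r, G v r /\ z = p (x + v) - r].

Section ConeMinorant.
Variables (p : V -> R) (G : V -> R -> Prop).
Hypotheses (ps : sublinear p) (Gc : convex_cone G).
Hypothesis Gp : forall v r, G v r -> r <= p v.
Let S x := [set z | exists v r, G v r /\ z = p (x + v) - r].

Let S_lb x : lbound (S x) (- p (- x)).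
Proof.
move=> _ [v [r [Gvr ->]]]; have := Gp Gvr.
have := ps.1 (- x) (x + v); rewrite addKr; lra.
Qed.

Let S_has_inf x : has_inf (S x).
Proof.
split; last by exists (- p (- x)); exact: S_lb.
by exists (p (x + 0) - 0); exists 0, 0; split => //; case: Gc.
Qed.

Lemma cone_minorant_le x v r : G v r -> cone_minorant p G x <= p (x + v) - r.
Proof. by move=> Gvr; apply: ge_inf; [case: (S_has_inf x)|exists v, r]. Qed.

Let S_ge x c : lbound (S x) c -> c <= cone_minorant p G x.
Proof. by apply: lb_le_inf; case: (S_has_inf x). Qed.

Let S_adherent x e : 0 < e ->
  exists v r, G v r /\ p (x + v) - r < cone_minorant p G x + e.
Proof.
move=> e0; have [_ [v [r [Gvr ->]]] h] := inf_adherent e0 (S_has_inf x).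
by exists v, r.
Qed.

Lemma sublinear_cone_minorant : sublinear (cone_minorant p G).
Proof.
have sub x y :
    cone_minorant p G (x + y) <= cone_minorant p G x + cone_minorant p G y.
  apply/ler_addgt0Pr => e e0; have e20 : 0 < e / 2 by rewrite divr_gt0.
  have [v [r [Gvr h1]]] := S_adherent x e20.
  have [w [s [Gws h2]]] := S_adherent y e20.
  have [_ GD _] := Gc; have h3 := cone_minorant_le (x + y) (GD _ _ _ _ Gvr Gws).
  have := ps.1 (x + v) (y + w); rewrite addrACA => h4; lra.
(* One inequality suffices: [leZ] at [t^-1] and [t *: x] gives the converse. *)
have leZ t x : 0 < t -> t * cone_minorant p G x <= cone_minorant p G (t *: x).
  move=> t0; apply: S_ge => _ [v [r [Gvr ->]]].
  have [_ _ /(_ t^-1 v r)] := Gc; rewrite invr_ge0 => /(_ (ltW t0) Gvr) Gv.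
  have := cone_minorant_le x Gv; rewrite -(ler_pM2l t0) mulrBr mulrA divff ?gt_eqF//.
  by rewrite mul1r -(ps.2 _ _ (ltW t0)) scalerDr scalerA divff ?gt_eqF// scale1r.
have le0 : cone_minorant p G 0 = 0.
  apply/eqP; rewrite eq_le; have [G0 _ _] := Gc; apply/andP; split.
    by have := cone_minorant_le 0 G0; rewrite addr0 subr0 (sublinear0 ps).
  by apply: S_ge => z /S_lb; rewrite oppr0 (sublinear0 ps) oppr0.
split=> // t x; rewrite le_eqVlt => /predU1P[<-|t0].
  by rewrite scale0r le0 mul0r.
apply/eqP; rewrite eq_le leZ// andbT.
have := leZ t^-1 (t *: x); rewrite invr_gt0 => /(_ t0).
rewrite -(ler_pM2l t0) mulrA divff ?gt_eqF// mul1r.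
by rewrite scalerA mulVf ?gt_eqF// scale1r.
Qed.

End ConeMinorant.

(** A minimal sublinear functional [q] below [p] is linear: lowering [q] by the demand [q y <= g y]
    on the ray through [y] gives a sublinear functional below [q], equal to [q] by minimality, and
    this equality forces superadditivity. *)
Lemma sublinear_minorant_linear p : sublinear p ->
  exists g : {linear V -> R^o}, forall x, g x <= p x.
Proof.
move=> ps; pose T := {q : V -> R | sublinear q /\ forall x, q x <= p x}.
(* The order is reversed, so that Zorn's maximal element is pointwise minimal. *)
pose r (a b : T) := `[< forall x, sval b x <= sval a x >].
have [||||m mmin] := @Zorn T r.
- by move=> t; apply/asboolP.
- move=> a b c /asboolP ab /asboolP bc; apply/asboolP => x.
  exact: le_trans (ab x).
- move=> [a pa] [b pb] /asboolP ab /asboolP ba; apply: eq_exist.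
  by apply/funext => x; apply/eqP; rewrite eq_le ab ba.
- move=> A Atot; have [[a0 Aa0]|A0] := pselect (A !=set0); last first.
    by exists (exist _ p (conj ps (fun x => lexx (p x)))) => s As; case: A0; exists s.
  pose S x := [set sval a x | a in A].
  have Slb x : has_inf (S x).
    split; first by exists (sval a0 x), a0.
    exists (- p (- x)) => _ [[a [sa ap]] Aa <-] /=.
    have := sublinear_oppr x sa; have := ap (- x); lra.
  pose q x := inf (S x).
  have qle a x : A a -> q x <= sval a x.
    by move=> Aa; apply: ge_inf; [case: (Slb x)|exists a].
  have qge c x : (forall a, A a -> c <= sval a x) -> c <= q x.
    move=> h; apply: lb_le_inf; first by case: (Slb x).
    by move=> _ [a Aa <-]; exact: h.
  have sq : sublinear q.
    split=> [x y|t x t0].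
      apply/ler_addgt0Pr => e e0; have e20 : 0 < e / 2 by rewrite divr_gt0.
      have [_ [a Aa <-] ha] := inf_adherent e20 (Slb x).
      have [_ [b Ab <-] hb] := inf_adherent e20 (Slb y).
      rewrite -/(q x) -/(q y) in ha hb.
      have [/asboolP ab|/asboolP ba] := Atot _ _ Aa Ab.
        have := qle b (x + y) Ab; have := (svalP b).1.1 x y; have := ab x; lra.
      have := qle a (x + y) Aa; have := (svalP a).1.1 x y; have := ba y; lra.
    move: t0; rewrite le_eqVlt => /predU1P[<-|t0].
      rewrite scale0r mul0r; apply/eqP; rewrite eq_le qge ?andbT.
        by apply: (le_trans (qle _ _ Aa0)); rewrite (sublinear0 (svalP a0).1).
      by move=> a Aa; rewrite (sublinear0 (svalP a).1).
    apply/eqP; rewrite eq_le; apply/andP; split.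
      rewrite -ler_pdivrMl//; apply: qge => a Aa; rewrite ler_pdivrMl//.
      by rewrite -((svalP a).1.2 _ _ (ltW t0)); exact: qle.
    apply: qge => a Aa; rewrite ((svalP a).1.2 _ _ (ltW t0)) ler_pM2l//; exact: qle.
  have qp x : q x <= p x by apply: (le_trans (qle _ x Aa0)); exact: (svalP a0).2.
  by exists (exist _ q (conj sq qp)) => s As; apply/asboolP => x; exact: qle.
have ms := (svalP m).1; have mp := (svalP m).2; set q := sval m in ms mp.
have superadd y x : q x + q y <= q (x + y).
  pose G v s := exists2 t, 0 <= t & v = t *: y /\ s = t * q y.
  have Gc : convex_cone G.
    split=> [|v w s s' [t t0 [-> ->]] [t' t0' [-> ->]]|t v s t0 [t' t0' [-> ->]]].
    - by exists 0 => //; rewrite scale0r mul0r.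
    - by exists (t + t'); rewrite ?addr_ge0// scalerDl mulrDl.
    - by exists (t * t'); rewrite ?mulr_ge0// scalerA mulrA.
  have Gq v s : G v s -> s <= q v by case=> t t0 [-> ->]; rewrite ms.2.
  have G0 : G 0 0 by case: Gc.
  have mq z : cone_minorant q G z <= q z.
    by have := cone_minorant_le ms Gc Gq z G0; rewrite addr0 subr0.
  have H : sublinear (cone_minorant q G) /\ forall x, cone_minorant q G x <= p x.
    split; first exact: sublinear_cone_minorant.
    by move=> z; exact: le_trans (mp z).
  have e : exist _ _ H = m by apply: mmin; apply/asboolP.
  have Gy : G y (q y) by exists 1; rewrite ?scale1r ?mul1r.
  have := cone_minorant_le ms Gc Gq x Gy.
  by have -> : cone_minorant q G = q := congr1 sval e; lra.
have qD x y : q (x + y) = q x + q y.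
  by apply/eqP; rewrite eq_le ms.1 superadd.
have qN x : q (- x) = - q x.
  have := qD x (- x); rewrite subrr (sublinear0 ms); lra.
have ql : linear (q : V -> R^o).
  move=> t x y; rewrite qD; congr (_ + _); have [t0|t0] := leP 0 t.
    by rewrite ms.2.
  by rewrite -[t]opprK scaleNr qN ms.2 ?oppr_ge0 ?ltW// scaleNr.
pose g := GRing.isLinear.Build _ _ _ _ _ ql.
pose h : {linear V -> R^o} := HB.pack q g.
by exists h.
Qed.

(** The one form of Hahn-Banach used below: norming functionals, separation and approximate
    barycenters differ only in the choice of [G]. At [- v] the cone minorant is at most [- r],
    whence [r <= g v]. *)
Lemma mazur_orlicz p G : sublinear p -> convex_cone G ->
  (forall v r, G v r -> r <= p v) ->
  exists2 g : {linear V -> R^o},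
    (forall x, g x <= p x) & forall v r, G v r -> r <= g v.
Proof.
move=> ps Gc Gp.
have [g gp] := sublinear_minorant_linear (sublinear_cone_minorant ps Gc Gp).
have G0 : G 0 0 by case: Gc.
exists g => [x|v r Gvr].
  by have := cone_minorant_le ps Gc Gp x G0; rewrite addr0 subr0; exact: le_trans.
have := cone_minorant_le ps Gc Gp (- v) Gvr.
by rewrite addNr (sublinear0 ps); have := gp (- v); rewrite linearN /=; lra.
Qed.

End HahnBanach.

(** * Weak topology *)

Lemma convex_setP (R : realType) (V : lmodType R) (A : set (convex_lmodType V)) :
  convex_set A <-> forall x y (t : R), A x -> A y -> 0 <= t <= 1 ->
    A (t *: x + (1 - t) *: y).
Proof.
split=> [Ac x y t Ax Ay /andP[t0 t1]|Ac x y l].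
  by have := Ac x y (Itv01 t0 t1); rewrite !inE => /(_ Ax Ay).
rewrite !inE => Ax Ay; apply: Ac => //.
by apply/andP; split; [exact: ge0|exact: le1].
Qed.

Lemma ultra_image_fmap (T U : Type) (f : T -> U) (F : set_system T) :
  UltraFilter F -> UltraFilter (f @ F).
Proof.
move=> FU; split; first exact: fmap_proper_filter.
move=> G GF FG; rewrite eqEsubset; split => // A GA.
have [//|FnA] := in_ultra_setVsetC (f @^-1` A) FU.
have /FG GnA : (f @ F) (~` A) by [].
by have /filter_ex[? []] : G (A `&` ~` A) by exact: filterI.
Qed.

Definition dual_fun (R : realType) (E : normedModType R) (f : dual E) (x : E) : R :=
  sval f x.
Coercion dual_fun : dual >-> Funclass.

Section Weak.
Context {R : realType} {E : normedModType R}.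
Implicit Types (f : dual E) (A K M : set E) (x y : E).

Lemma dual_bound f : exists2 M, 0 < M & forall x, `|f x| <= M * `|x|.
Proof.
case: f => f fc; rewrite /dual_fun /=.
have /linear_bounded_continuous/linear_boundedP := fc.
case=> M [Mr Mf]; exists (`|M| + 1); first by rewrite ltr_wpDl.
by apply: Mf; rewrite ltr_pwDr// ler_norm.
Qed.

Lemma bounded_dual (g : {linear E -> R^o}) (C : R) :
  (forall x, `|g x| <= C * `|x|) -> exists f : dual E, forall x, f x = g x.
Proof.
move=> gC; have gc : continuous g.
  apply/linear_bounded_continuous/linear_boundedP; exists `|C|.
  split=> [|r rC x]; first by rewrite num_real.
  apply: le_trans (gC x) _; rewrite ler_wpM2r//.
  by apply: le_trans (ltW rC); exact: ler_norm.
by exists (exist _ g gc).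
Qed.

Lemma dualD f x y : f (x + y) = f x + f y.
Proof. by rewrite /dual_fun linearD. Qed.

Lemma dualB f x y : f (x - y) = f x - f y.
Proof. by rewrite /dual_fun linearB. Qed.

Lemma dualZ f (t : R) x : f (t *: x) = t * f x.
Proof. by rewrite /dual_fun linearZ. Qed.

Lemma sublinear_norm : sublinear (fun x : E => `|x|).
Proof.
split=> [x y|t x t0]; first exact: ler_normD.
by rewrite normrZ ger0_norm.
Qed.

Lemma norm_minorant_bound (g : {linear E -> R^o}) :
  (forall x, g x <= `|x|) -> exists2 f : dual E, (forall x, f x = g x) &
    forall x, `|f x| <= `|x|.
Proof.
move=> g1; have gN x : `|g x| <= `|x|.
  rewrite ler_norml g1 andbT lerNl.
  by have := g1 (- x); rewrite linearN normrN.
have [x|f fg] := @bounded_dual g 1; first by rewrite mul1r.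
by exists f => // x; rewrite fg.
Qed.

Lemma norming_functional x :
  exists2 f : dual E, (forall y, `|f y| <= `|y|) & f x = `|x|.
Proof.
pose G v r := exists2 t, 0 <= t & v = t *: x /\ r = t * `|x|.
have [|v r [t t0 [-> ->]]|g g1 gx] := mazur_orlicz sublinear_norm (G := G).
- split=> [|v w s s' [t t0 [-> ->]] [t' t0' [-> ->]]|t v s t0 [t' t0' [-> ->]]].
  + by exists 0 => //; rewrite scale0r mul0r.
  + by exists (t + t'); rewrite ?addr_ge0// scalerDl mulrDl.
  + by exists (t * t'); rewrite ?mulr_ge0// scalerA mulrA.
- by rewrite normrZ ger0_norm.
have [f fg f1] := norm_minorant_bound g1.
exists f => //; apply/eqP; rewrite eq_le (le_trans (ler_norm _))//=.
by rewrite fg; apply: gx; exists 1; rewrite ?scale1r ?mul1r.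
Qed.

(** The demands [e <= g (x - y)], for [y] in [A], are compatible with the norm because [A] stays at
    distance [e] from [x]; convexity of [A] closes them under addition. *)
Lemma closed_convex_separation A x : closed A ->
  convex_set (A : set (convex_lmodType E)) -> ~ A x ->
  exists f : dual E, exists2 e : R, 0 < e & forall y, A y -> f y + e <= f x.
Proof.
move=> Acl /convex_setP Acv Ax.
have [e e0 He] : exists2 e : R, 0 < e & forall y, A y -> e <= `|x - y|.
  have : nbhs x (~` A) by apply: open_nbhs_nbhs; split => //; exact: closed_openC.
  move=> /nbhs_ballP[e /= e0 eA]; exists e => // y Ay; rewrite leNgt.
  by apply/negP => h; apply: (eA y) => //; rewrite -ball_normE.
(* The zero demand is listed apart, since [A] may be empty and the other multipliers are kept
   positive. *)
pose G v r := (v = 0 /\ r = 0) \/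
  exists t y, [/\ 0 < t, A y, v = t *: (x - y) & r = t * e].
have [||g g1 gG] := mazur_orlicz sublinear_norm (G := G).
- split.
  + by left.
  + move=> v w r s [[-> ->]|[t [y [t0 Ay -> ->]]]]; first by rewrite !add0r.
    move=> [[-> ->]|[t' [y' [t0' Ay' -> ->]]]].
      by rewrite !addr0; right; exists t, y.
    right; have tt0 : 0 < t + t' by rewrite addr_gt0.
    have tne : t + t' != 0 by rewrite gt_eqF.
    pose c := t / (t + t').
    exists (t + t'), (c *: y + (1 - c) *: y'); split => //; last by rewrite mulrDl.
      apply: Acv => //; rewrite divr_ge0 ?(ltW t0) ?(ltW tt0)//=.
      by rewrite ler_pdivrMr// mul1r lerDl ltW.
    rewrite !scalerBr scalerDr !scalerA scalerDl.
    have -> : (t + t') * c = t by rewrite /c mulrC divfK.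
    have -> : (t + t') * (1 - c) = t' by rewrite /c; field.
    by rewrite opprD addrACA.
  + move=> t v r t0 [[-> ->]|[t' [y [t0' Ay -> ->]]]].
      by left; rewrite scaler0 mulr0.
    move: t0; rewrite le_eqVlt => /predU1P[<-|t0].
      by left; rewrite scale0r mul0r.
    by right; exists (t * t'), y; rewrite mulr_gt0 // scalerA mulrA.
- move=> v r [[-> ->]|[t [y [t0 Ay -> ->]]]]; first by rewrite normr0.
  by rewrite normrZ gtr0_norm// ler_pM2l// He.
have [f fg _] := norm_minorant_bound g1.
exists f, e => // y Ay; rewrite !fg addrC -lerBrDr.
have := gG (x - y) e; rewrite linearB; apply; right.
by exists 1, y; rewrite scale1r mul1r ltr01.
Qed.

Definition weak_lim {T} (F : set_system T) (s : T -> E) x :=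
  forall f, (fun t => f (s t) : R) @ F --> (f x : R).

Lemma weak_cvgE (F : set_system E) x : Filter F ->
  (F --> (x : weak E)) <-> weak_lim F id x.
Proof.
move=> FF; rewrite cvg_sup; split=> [h f|h f].
  apply: cvg_trans (cvg_app _ (h f)) _.
  exact: (@initial_continuous _ _ (sval f) x).
move=> B /= [_ [[C Cop <-] Cx CB]].
apply: filterS CB _; apply: (h f C).
exact: open_nbhs_nbhs.
Qed.

End Weak.

Lemma ultra_bounded_cvg (R : realType) (T : Type) (F : set_system T) (g : T -> R)
  (M : R) : UltraFilter F -> (forall t, `|g t| <= M) -> exists l : R, g @ F --> l.
Proof.
move=> FU gM; have := @segment_compact R (- M) M; rewrite compact_ultra.
move=> /(_ (g @ F) (ultra_image_fmap g FU)) [].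
  apply: (@filterE T F) => t /=; rewrite in_itv /=; have := gM t.
  by rewrite ler_norml => /andP[-> ->].
by move=> l [_ gl]; exists l.
Qed.

(** If [u] leaves a neighbourhood of [l] infinitely often, the trace of [\oo] on those indices is
    proper, and no finer ultrafilter sends [u] to [l]. *)
Lemma cvgn_ultra (R : realType) (u : nat -> R) (l : R) :
  (forall V : set_system nat, UltraFilter V -> \oo `<=` V -> u @ V --> l) ->
  u @ \oo --> l.
Proof.
move=> h A Al; apply: contrapT => nA.
pose F := within (~` (u @^-1` A)) \oo.
have FP : ProperFilter F.
  apply: Build_ProperFilter_ex => B FB; apply: contrapT => nB; apply: nA.
  move: FB; rewrite /F /within /=; apply: filterS => n Bn.
  by apply: contrapT => nAn; apply: nB; exists n; exact: Bn.
have [V [VU FV]] := ultraFilterLemma FP.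
have ooV : \oo `<=` V by move=> B oB; apply: FV; apply: filterS oB => n Bn _.
have VA : V (u @^-1` A) by apply: (h V VU ooV).
have VnA : V (~` (u @^-1` A)) by apply: FV; apply: (@filterE _ \oo).
have VF : ProperFilter V by exact: ultra_proper.
have [n [An nAn]] : exists n, (u @^-1` A `&` ~` (u @^-1` A)) n.
  by apply: (@filter_ex _ V); exact: filterI.
exact: nAn An.
Qed.

Section WeakLim.
Context {R : realType} {E : normedModType R}.
Implicit Types (f : dual E) (A K M : set E) (x y : E).

Section Filter.
Context {T : Type} (F : set_system T) {FF : ProperFilter F}.
Implicit Types s : T -> E.

Lemma weak_lim_unique s x y : weak_lim F s x -> weak_lim F s y -> x = y.
Proof.
move=> sx sy; apply/eqP; rewrite -subr_eq0 -normr_eq0.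
have [f _ <-] := norming_functional (x - y); rewrite dualB subr_eq0; apply/eqP.
exact: (cvg_unique _ (sx f) (sy f)).
Qed.

(** A functional separating [x] from [A] keeps [f (s t)] below [f x - e]. This is Mazur's theorem:
    closed convex sets are weakly closed. *)
Lemma weak_lim_closed_convex s x A : closed A -> convex_set (A : set (convex_lmodType E)) ->
  F (s @^-1` A) -> weak_lim F s x -> A x.
Proof.
move=> Acl Acv FA sx; apply: contrapT => Ax.
have [f [e e0 fe]] := closed_convex_separation Acl Acv Ax.
have : f x <= f x - e.
  apply: (@closed_cvg _ _ F FF (fun t => f (s t) : R) [set z | z <= f x - e]).
  - exact: closed_le.
  - by apply: filterS FA => t /fe; rewrite /= lerBrDr.
  - exact: sx.
by rewrite lerDl oppr_ge0 leNgt e0.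
Qed.

Lemma weak_lim_norm_le s x (r : R) : F [set t | `|s t| <= r] ->
  weak_lim F s x -> `|x| <= r.
Proof.
move=> Fr sx; have [f f1 <-] := norming_functional x.
apply: (@closed_cvg _ _ F FF (fun t => f (s t) : R) [set z | z <= r]).
- exact: closed_le.
- apply: filterS Fr => t /=; apply: le_trans; exact: le_trans (ler_norm _) (f1 _).
- exact: sx.
Qed.

End Filter.

Section Operations.
Context {T : Type} (F : set_system T) {FF : Filter F}.
Implicit Types s : T -> E.

Lemma weak_lim_cst x : weak_lim F (fun=> x) x.
Proof. by move=> f; exact: cvg_cst. Qed.

Lemma weak_limD s s' x x' : weak_lim F s x -> weak_lim F s' x' ->
  weak_lim F (fun t => s t + s' t) (x + x').
Proof.
by move=> sx sx' f; under eq_fun do rewrite dualD; rewrite dualD; exact: cvgD.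
Qed.

Lemma weak_limB s s' x x' : weak_lim F s x -> weak_lim F s' x' ->
  weak_lim F (fun t => s t - s' t) (x - x').
Proof.
by move=> sx sx' f; under eq_fun do rewrite dualB; rewrite dualB; exact: cvgB.
Qed.

(** A three-epsilon argument, each functional being bounded. The approximating family and its limit
    may both change with [e]. *)
Lemma weak_lim_approx s x :
  (forall e : R, 0 < e -> exists s' x', [/\ weak_lim F s' x', `|x - x'| <= e &
     F [set t | `|s t - s' t| <= e]]) -> weak_lim F s x.
Proof.
move=> h f; apply/cvgrPdist_le => e e0.
have [M M0 fM] := dual_bound f.
have d0 : 0 < e / 3 / M by rewrite !divr_gt0.
have [s' [x' [s'x' xx' Fs]]] := h _ d0.
have /cvgrPdist_le/(_ (e / 3)) := s'x' f; rewrite divr_gt0// => /(_ isT).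
apply: filterS2 Fs => t /= h1 h2.
have b y : `|y| <= e / 3 / M -> `|f y| <= e / 3.
  by move=> hy; apply: le_trans (fM _) _; rewrite mulrC -ler_pdivlMr.
have := b _ xx'; have := b _ h1; rewrite !dualB => h3 h4.
have -> : f x - f (s t) = (f x - f x') +
  (f x' - f (s' t)) - (f (s t) - f (s' t)).
  set a := f x; set c := f (s t); set d := f x'; set g := f (s' t).
  have : a - c = a - d + (d - g) - (c - g) :> R by ring.
  by [].
apply: (le_trans (ler_normB _ _)).
have := ler_normD (f x - f x') (f x' - f (s' t)).
rewrite /= in h2 *; lra.
Qed.

Lemma cvg_weak_lim s x : s @ F --> x -> weak_lim F s x.
Proof.
move=> sx; apply: weak_lim_approx => e e0; exists (fun=> x), x.
split; first exact: weak_lim_cst.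
  by rewrite subrr normr0 ltW.
have /cvgrPdist_le/(_ _ e0) := sx; apply: filterS => t; by rewrite distrC.
Qed.

End Operations.

Lemma weak_lim_sub {T} (F G : set_system T) (s : T -> E) x :
  F `<=` G -> weak_lim F s x -> weak_lim G s x.
Proof. by move=> FG sx f; apply: cvg_trans (sx f) => A /FG. Qed.

Lemma weak_cvgP (x_ : nat -> E) x : weak_cvg x_ x <-> weak_lim \oo x_ x.
Proof. by rewrite /weak_cvg weak_cvgE. Qed.

Lemma weak_lim_subseq (x_ : nat -> E) x (i_ : nat -> nat) :
  weak_lim \oo x_ x -> i_ @ \oo --> \oo -> weak_lim \oo (x_ \o i_) x.
Proof. by move=> xx ii f; apply: cvg_comp (xx f). Qed.

(* Every ultrafilter on [M] converges weakly to a point of [E]; this is relative weak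
   compactness, in a form stable under the passage to images and sums. *)
Definition ultra_weakly_cvg M := forall F : set_system E, UltraFilter F -> F M ->
  exists x, weak_lim F id x.

Lemma ultra_weakly_cvgW M M' : M `<=` M' -> ultra_weakly_cvg M' -> ultra_weakly_cvg M.
Proof. by move=> MM h F FU FM; apply: h; apply: filterS FM. Qed.

Lemma ultra_weakly_cvg_fam M : ultra_weakly_cvg M -> forall (T : Type) (V : set_system T)
  (s : T -> E), UltraFilter V -> V (s @^-1` M) -> exists x, weak_lim V s x.
Proof.
by move=> h T V s VU VM; have [x sx] := h _ (ultra_image_fmap s VU) VM; exists x.
Qed.

(** An ultrafilter containing the range pulls back to a proper filter on indices; any ultrafilter
    finer than the pull-back is pushed forward onto the original one, by maximality. *)
Lemma ultra_weakly_cvg_range (I : Type) (s : I -> E) :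
  (forall V : set_system I, UltraFilter V -> exists x, weak_lim V s x) ->
  ultra_weakly_cvg (range s).
Proof.
move=> h F FU FM.
pose G := filter_from F (fun A => s @^-1` A).
have GP : ProperFilter G.
  apply: filter_from_proper; last first.
    move=> A FA; have /filter_ex[x [Ax [i _ ix]]] : F (A `&` range s) by exact: filterI.
    by exists i; rewrite /preimage /= ix.
  apply: filter_from_filter; first by exists setT; exact: filterT.
  by move=> A B FA FB; exists (A `&` B) => //; exact: filterI.
have [V [VU GV]] := ultraFilterLemma GP.
have [x sx] := h V VU; exists x.
suff -> : F = s @ V by [].
apply: esym; apply: max_filter => A FA; rewrite /= ; apply: GV; by exists A.
Qed.

Lemma weakly_compact_ultra K : weakly_compact K -> ultra_weakly_cvg K.
Proof.
rewrite /weakly_compact compact_ultra => h F FU FK.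
by have [x [_ /weak_cvgE Fx]] := h F FU FK; exists x.
Qed.

Lemma relatively_weakly_compact_ultra K : relatively_weakly_compact K -> ultra_weakly_cvg K.
Proof.
by move=> [B KB [Bc _]]; apply: ultra_weakly_cvgW KB (weakly_compact_ultra Bc).
Qed.

Lemma ultra_weakly_compact K : ultra_weakly_cvg K ->
  (forall (F : set_system E) x, UltraFilter F -> F K -> weak_lim F id x -> K x) ->
  weakly_compact K.
Proof.
move=> h hK; rewrite /weakly_compact compact_ultra => F FU FK.
by have [x Fx] := h F FU FK; exists x; split; [exact: hK Fx|exact/weak_cvgE].
Qed.

Lemma closed_convex_weakly_compact K : closed K -> convex_set (K : set (convex_lmodType E)) ->
  ultra_weakly_cvg K -> weakly_compact K.
Proof.
move=> Kcl Kcv h; apply: ultra_weakly_compact => // F x FU FK Fx.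
exact: (weak_lim_closed_convex Kcl Kcv FK Fx).
Qed.

End WeakLim.

Lemma near_harmonic (R : realType) (e : R) : 0 < e ->
  \forall n \near \oo, n.+1%:R^-1 <= e.
Proof.
move=> e0; have /cvgrPdist_le/(_ _ e0) := @cvg_harmonic R.
by apply: filterS => n; rewrite sub0r normrN ger0_norm ?invr_ge0.
Qed.

Lemma cauchy_harmonic_cvg (R : realType) (E : completeNormedModType R) (z : nat -> E) :
  (forall n m, `|z n - z m| <= n.+1%:R^-1 + m.+1%:R^-1) ->
  exists l, forall e : R, 0 < e -> exists n, n.+1%:R^-1 <= e /\ `|l - z n| <= e.
Proof.
move=> zz; have zc : cvgn z.
  apply/cauchy_cvgP/cauchy_exP => d d0.
  have d30 : 0 < d / 3 by rewrite divr_gt0.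
  have [N _ HN] := near_harmonic d30.
  exists (z N), N => // n Nn /=; rewrite -ball_normE /= (le_lt_trans (zz _ _))//.
  by apply: le_lt_trans (lerD (HN _ (leqnn N)) (HN _ Nn)) _; lra.
exists (limn z) => d d0.
have /cvgrPdist_le/(_ _ d0) zl : z @ \oo --> limn z := zc.
by have [n [nd zn]] := @filter_ex _ _ _ _ (filterI (near_harmonic d0) zl); exists n.
Qed.

(** The approximants at scale [1 / n.+1] have weak limits [z n] along [F]. The norm being weakly
    lower semicontinuous, [z] is Cauchy, and its norm limit is the weak limit of [F]. *)
Lemma ultra_weakly_cvg_approx (R : realType) (E : completeNormedModType R) (M : set E) :
  (forall e : R, 0 < e -> exists2 K : set E, ultra_weakly_cvg K &
     forall x, M x -> exists2 k, K k & `|x - k| <= e) ->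
  ultra_weakly_cvg M.
Proof.
move=> h F FU FM.
pose e n : R := n.+1%:R^-1.
have e0 n : 0 < e n by rewrite invr_gt0.
have /choice[K hK] : forall n, exists K : set E, ultra_weakly_cvg K /\
     forall x, M x -> exists2 k, K k & `|x - k| <= e n.
  by move=> n; have [K] := h _ (e0 n); exists K.
have /choice[k hk] : forall nx : nat * E, exists k, M nx.2 -> K nx.1 k /\ `|nx.2 - k| <= e nx.1.
  move=> [n x] /=; have [Mx|Mx] := pselect (M x); last by exists 0.
  by have [k] := (hK n).2 x Mx; exists k.
have /choice[z hz] : forall n, exists z, weak_lim F (fun x => k (n, x)) z.
  move=> n; apply: (ultra_weakly_cvg_fam (hK n).1).
  by apply: filterS FM => x Mx; exact: (hk (n, x) Mx).1.
have zz n m : `|z n - z m| <= e n + e m.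
  apply: (weak_lim_norm_le _ (weak_limB (hz n) (hz m))).
  apply: filterS FM => x Mx /=.
  have [_ /= h1] := hk (n, x) Mx; have [_ /= h2] := hk (m, x) Mx.
  have -> : k (n, x) - k (m, x) = (x - k (m, x)) - (x - k (n, x)).
    by rewrite opprB [RHS]addrC subrKA.
  by rewrite (le_trans (ler_normB _ _))// addrC lerD.
have [l hl] := cauchy_harmonic_cvg zz; exists l; apply: weak_lim_approx => d d0.
have [n [nd lz]] := hl d d0.
exists (fun x => k (n, x)), (z n); split => //.
apply: filterS FM => x Mx /=; have [_ /= h1] := hk (n, x) Mx.
exact: le_trans nd.
Qed.

(** * Krein's theorem *)

Section Means.
Context {R : realType}.

Definition bounded_real_fun {T : Type} (g : T -> R) := exists M, forall t, `|g t| <= M.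

(** Integration against a finitely additive probability on [T]. The functional [q] is total, but
    constrained at bounded functions only. *)
Definition mean {T : Type} (q : (T -> R) -> R) :=
  [/\ forall g h, bounded_real_fun g -> bounded_real_fun h -> q (g \+ h) = q g + q h,
      forall c g, bounded_real_fun g -> q (fun t => c * g t) = c * q g,
      forall g h, bounded_real_fun g -> bounded_real_fun h ->
        (forall t, g t <= h t) -> q g <= q h
    & forall c, q (fun=> c) = c].

Lemma mean_norm_le {T : Type} (q : (T -> R) -> R) g (M : R) : mean q ->
  (forall t, `|g t| <= M) -> `|q g| <= M.
Proof.
move=> [_ _ qle qc] gM.
have bc c : bounded_real_fun (fun _ : T => c) by exists `|c|.
have gb : bounded_real_fun g by exists M.
rewrite ler_norml -{1}(qc (- M)) -{2}(qc M) !qle// => t; have := gM t;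
  by rewrite ler_norml => /andP[].
Qed.

(** A finite stand-in for the supremum of a tail, through which a finitely additive mean cannot be
    expected to pass. *)
Fixpoint tail_max {T : Type} (f : nat -> T -> R) (n k : nat) (t : T) : R :=
  if k is k'.+1 then Num.max (tail_max f n k' t) (f (n + k)%N t) else f n t.

Lemma tail_max_le {T} (f : nat -> T -> R) n k t (c : R) :
  (forall j, (n <= j)%N -> f j t <= c) -> tail_max f n k t <= c.
Proof.
move=> fc; elim: k => [|k IH] /=; first exact: fc.
by rewrite ge_max IH fc// leq_addr.
Qed.

Lemma tail_max_ge {T} (f : nat -> T -> R) n k j t : (n <= j <= n + k)%N ->
  f j t <= tail_max f n k t.
Proof.
elim: k => [|k IH] /=; first by rewrite addn0 -eqn_leq => /eqP ->.
move=> /andP[nj]; rewrite leq_eqVlt => /predU1P[->|].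
  by rewrite le_max lexx orbT.
by rewrite addnS ltnS => jk; rewrite le_max IH ?nj.
Qed.

Lemma tail_max_leP {T} (f : nat -> T -> R) n k t (c : R) :
  (forall j, (n <= j <= n + k)%N -> f j t <= c) -> tail_max f n k t <= c.
Proof.
elim: k => [|k IH] h /=; first by apply: h; rewrite addn0 leqnn.
rewrite ge_max IH ?h ?leq_addr ?leqnn// => j /andP[nj jk]; apply: h.
by rewrite nj (leq_trans jk)// leq_add2l.
Qed.

(* Dominated convergence for finitely additive means: convergence to [0] along every
   ultrafilter is pointwise convergence on the Stone-Cech compactification of [T]. *)
Lemma mean_dominated_convergence {T : Type} (q : (T -> R) -> R) (f : nat -> T -> R) :
  mean q -> (forall n t, 0 <= f n t <= 1) ->
  (forall (V : set_system T) (e : R), UltraFilter V -> 0 < e ->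
    exists N, forall n, (N <= n)%N -> V [set t | f n t <= e]) ->
  forall e : R, 0 < e -> exists n, q (f n) <= e.
Proof.
move=> qm f01 fV e e0; have [qD _ qle qc] := qm.
have G01 n k t : 0 <= tail_max f n k t <= 1.
  apply/andP; split.
    apply: (@le_trans _ _ (f n t)); first by have /andP[] := f01 n t.
    by apply: tail_max_ge; rewrite leqnn leq_addr.
  by apply: tail_max_le => j _; have /andP[] := f01 j t.
have b01 (g : T -> R) : (forall t, 0 <= g t <= 1) -> bounded_real_fun g.
  by move=> g01; exists 1 => t; have /andP[g0 g1] := g01 t; rewrite ger0_norm.
have q1 (g : T -> R) : (forall t, 0 <= g t <= 1) -> q g <= 1.
  move=> g01; rewrite -(qc 1); apply: qle; [exact: b01| |].
    by exists 1 => t; rewrite normr1.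
  by move=> t; have /andP[] := g01 t.
pose d := e / 2; have d0 : 0 < d by rewrite divr_gt0.
(* The block of length [m n] starting at [n] is such that extending it raises its mean by at most
   [d / 2^(n+1)]; these losses sum to at most [d]. *)
have /choice[m hm] : forall n, exists k, forall k',
    q (tail_max f n k') <= q (tail_max f n k) + d * 2^-1 ^+ n.+1.
  move=> n; pose S := [set q (tail_max f n k) | k in [set: nat]].
  have hS : has_sup S.
    split; first by exists (q (tail_max f n 0)), 0%N.
    by exists 1 => _ [k _ <-]; exact/q1/G01.
  have c0 : 0 < d * 2^-1 ^+ n.+1 by rewrite mulr_gt0// exprn_gt0.
  have [_ [k _ <-] hk] := sup_adherent c0 hS.
  exists k => k'; rewrite -lerBlDr (le_trans _ (ltW hk))//.
  by rewrite lerB// ub_le_sup//; [case: hS|exists k'].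
pose g n := tail_max f n (m n).
pose fix h n := if n is n'.+1 then fun t => Num.min (h n' t) (g n t) else g 0%N.
have hg n t : h n t <= g n t by case: n => [|n] //=; rewrite ge_min lexx orbT.
have h01 n t : 0 <= h n t <= 1.
  apply/andP; split; last by apply: (le_trans (hg n t)); have /andP[] := G01 n (m n) t.
  elim: n => [|n IH] /=; first by have /andP[] := G01 0%N (m 0%N) t.
  by rewrite le_min IH; have /andP[] := G01 n.+1 (m n.+1) t.
have hdec n n' t : (n <= n')%N -> h n' t <= h n t.
  move=> /subnK <-; elim: (n' - n)%N => [|p IH] //=.
  by rewrite ge_min IH.
(* Replacing [g] by its running minimum [h] costs little: the maximum of [h n] and [g n.+1] lies
   below a longer block starting at [n], and maximum plus minimum is the sum. *)
have key n : q (g n) - q (h n) <= d * (1 - 2^-1 ^+ n).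
  elim: n => [|n IH]; first by rewrite subrr expr0 subrr mulr0.
  pose mx t := Num.max (h n t) (g n.+1 t).
  have mx01 t : 0 <= mx t <= 1.
    rewrite le_max ge_max; have /andP[-> ->] := h01 n t.
    by have /andP[_ ->] := G01 n.+1 (m n.+1) t.
  have e1 : q mx + q (h n.+1) = q (h n) + q (g n.+1).
    rewrite -!qD; try by apply: b01 => t; rewrite ?h01 ?mx01 ?G01.
    by congr q; apply/funext => t /=; rewrite addr_max_min.
  (* The block of [g n.+1] starts one index later than [n], whence the successor. *)
  pose K := maxn (m n) (m n.+1).+1.
  have e2 : q mx <= q (g n) + d * 2^-1 ^+ n.+1.
    apply: le_trans (hm n K); apply: qle => [||t]; [exact: b01|exact/b01/G01|].
    rewrite ge_max; apply/andP; split.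
      apply: (le_trans (hg n t)); apply: tail_max_leP => j /andP[nj jk].
      by apply: tail_max_ge; rewrite nj (leq_trans jk)// leq_add2l leq_maxl.
    apply: tail_max_leP => j /andP[nj jk].
    apply: tail_max_ge; rewrite (ltnW nj)/= (leq_trans jk)// addSnnS leq_add2l.
    exact: leq_maxr.
  have -> : d * (1 - 2^-1 ^+ n.+1) = d * (1 - 2^-1 ^+ n) + d * 2^-1 ^+ n.+1.
    by rewrite exprS; field.
  lra.
(* Otherwise take points [t n] with [d < h n (t n)]. An ultrafilter finer than their sequence sees
   every block exceed [d], whereas convergence along it makes the finitely many terms of a late
   block at most [d]. *)
have [n hn] : exists n, forall t, h n t <= d.
  apply: contrapT => /forallNP nh.
  have /choice[t ht] : forall n, exists t, d < h n t.
    by move=> n; have /existsNP[t /negP] := nh n; rewrite -ltNge => ?; exists t.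
  have [V [VU tV]] := ultraFilterLemma (fmap_proper_filter t (@eventually_filter)).
  have [N HN] := fV V d VU d0.
  have V1 : V [set s | d < g N s].
    apply: tV; exists N => // n /= Nn; apply: lt_le_trans (hg N _).
    exact: lt_le_trans (hdec _ _ _ Nn).
  have V2 k : V [set s | tail_max f N k s <= d].
    elim: k => [|k IH] /=; first exact: HN.
    have := HN _ (leq_addr k.+1 N); apply: filterS2 IH => s /=.
    by rewrite ge_max => -> ->.
  have [s [/= s1 s2]] : exists s, ([set s | d < g N s] `&` [set s | tail_max f N (m N) s <= d]) s.
    by apply: (@filter_ex _ V); exact: filterI.
  by move: s1; rewrite ltNge s2.
exists n; have h1 : q (f n) <= q (g n).
  apply: qle => [||t]; [exact: b01|exact/b01/G01|].
  by apply: tail_max_ge; rewrite leqnn leq_addr.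
have h2 : q (h n) <= d.
  rewrite -(qc d); apply: qle => //; first exact: b01.
  by exists `|d|.
have h3 : d * (1 - 2^-1 ^+ n) <= d.
  by rewrite ler_piMr ?(ltW d0)// gerBl exprn_ge0.
have h4 : d + d = e by rewrite /d -splitr.
have := key n; lra.
Qed.

End Means.

Section Krein.
Context {R : realType} {E : completeNormedModType R}.
Implicit Types (f : dual E) (A K M : set E) (x y z : E).

Lemma dual_addP f (g : dual E) : exists h : dual E, forall x, h x = f x + g x.
Proof.
have [Cf _ fC] := dual_bound f; have [Cg _ gC] := dual_bound g.
have [x|h hE] := @bounded_dual R E (sval f \+ sval g) (Cf + Cg).
  by rewrite mulrDl; apply: le_trans (ler_normD _ _) _; exact: lerD (fC x) (gC x).
by exists h => x; rewrite hE.
Qed.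

Lemma dual_scaleP (a : R) f : exists h : dual E, forall x, h x = a * f x.
Proof.
have [Cf _ fC] := dual_bound f.
have [x|h hE] := @bounded_dual R E (a \*: sval f) (`|a| * Cf).
  by rewrite normrM -mulrA ler_wpM2l//; exact: fC.
by exists h => x; rewrite hE.
Qed.

Section Barycenter.
Variables (k : nat -> E) (M : R).
Hypotheses (M0 : 0 < M) (kM : forall i, `|k i| <= M).
Hypothesis k_ultra : ultra_weakly_cvg (range k).

Let kb f : bounded_real_fun (f \o k).
Proof.
have [C C0 fC] := dual_bound f; exists (C * M) => t.
by apply: (le_trans (fC _)); rewrite ler_pM2l.
Qed.

Let fk_le f (C : R) : 0 <= C -> (forall x, `|f x| <= C * `|x|) ->
  forall i, `|f (k i)| <= C * M.
Proof. by move=> C0 fC i; apply: (le_trans (fC _)); rewrite ler_wpM2l. Qed.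

(** Failure would give [f n] in the dual unit ball tending to 0 at every [k i] while [q (f n \o k)]
    stays away from 0. Along any ultrafilter [k] has a weak limit, where [f n] tends to 0 as well,
    so dominated convergence applies. *)
Let mean_weak_star_continuous (q : (nat -> R) -> R) (e : R) : mean q -> 0 < e ->
  exists n, forall f, (forall x, `|f x| <= `|x|) ->
    (forall i, (i < n)%N -> `|f (k i)| <= n.+1%:R^-1) -> `|q (f \o k)| <= e.
Proof.
move=> qm e0; apply: contrapT => /forallNP H.
have /choice[f hf] : forall n, exists f, [/\ forall x, `|f x| <= `|x|,
    forall i, (i < n)%N -> `|f (k i)| <= n.+1%:R^-1 & e < `|q (f \o k)|].
  move=> n; have /existsNP[f /not_implyP[f1 /not_implyP[f2 /negP]]] := H n.
  by rewrite -ltNge => f3; exists f.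
pose F n t := `|f n (k t)| / M.
have F01 n t : 0 <= F n t <= 1.
  rewrite divr_ge0 ?(ltW M0)//= ler_pdivrMr// mul1r.
  by have [f1 _ _] := hf n; apply: le_trans (f1 _) _.
have FV (V : set_system nat) (d : R) : UltraFilter V -> 0 < d ->
    exists N, forall n, (N <= n)%N -> V [set t | F n t <= d].
  move=> VU d0.
  have [|x kx] := ultra_weakly_cvg_fam k_ultra VU (s := k).
    by apply: filterE => t /=; exists t.
  (* Convex, and closed because the [f n] lie in the dual unit ball; it contains the [k i], hence
     their weak limit along [V]. *)
  pose A := [set y | forall c : R, 0 < c -> \forall n \near \oo, `|f n y| <= c].
  have Ax : A x.
    apply: (weak_lim_closed_convex _ _ _ kx).
    - move=> y yA c c0; have c20 : 0 < c / 2 by rewrite divr_gt0.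
      have [y' [Ay' /= yy']] := yA _ (nbhsx_ballx y _ c20).
      apply: filterS (Ay' _ c20) => n h.
      rewrite -[y](subrK y') dualD (le_trans (ler_normD _ _))//.
      have [f1 _ _] := hf n; rewrite [leRHS]splitr lerD// (le_trans (f1 _))//.
      by move: yy'; rewrite -ball_normE /= => /ltW.
    - apply/convex_setP => y z t Ay Az /andP[t0 t1] c c0.
      apply: filterS2 (Ay _ c0) (Az _ c0) => n h1 h2.
      rewrite dualD !dualZ (le_trans (ler_normD _ _))// !normrM.
      rewrite (ger0_norm t0) (ger0_norm (x := 1 - t)) ?subr_ge0//.
      have -> : c = t * c + (1 - t) * c by ring.
      by rewrite lerD// ler_wpM2l// subr_ge0.
    - apply: filterE => i c c0.
      near=> n; have [_ f2 _] := hf n; apply: (le_trans (f2 i _)).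
        by near: n; exists i.+1.
      near: n; exact: near_harmonic.
  have dM : 0 < d * M / 2 by rewrite divr_gt0// mulr_gt0.
  have [N _ HN] := Ax _ dM; exists N => n Nn.
  have /cvgrPdist_le/(_ _ dM) := kx (f n).
  apply: filterS => t h1; rewrite /F /= ler_pdivrMr//.
  have -> : f n (k t) = f n x - (f n x - f n (k t)) by ring.
  rewrite (le_trans (ler_normB _ _))// [leRHS]splitr lerD//.
  exact: HN.
have [n hn] := mean_dominated_convergence qm F01 FV (e := e / M) (divr_gt0 e0 M0).
have [_ qZ qle _] := qm.
have [_ _] := hf n; apply/negP; rewrite -leNgt.
have bF : bounded_real_fun (F n).
  by exists 1 => t; have /andP[h0 h1] := F01 n t; rewrite ger0_norm.
have h1 : q (fun t => M * F n t) <= e.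
  by rewrite qZ// mulrC -ler_pdivlMr.
have MF t : M * F n t = `|f n (k t)| by rewrite /F mulrC divfK ?gt_eqF.
have bMF : bounded_real_fun (fun t => M * F n t).
  by have [C hC] := kb (f n); exists C => t; rewrite MF normr_id; exact: hC.
rewrite ler_norml; apply/andP; split.
  rewrite lerNl; apply: le_trans h1.
  have -> : - q (f n \o k) = q (fun t => -1 * (f n \o k) t) by rewrite qZ// mulN1r.
  apply: qle => // [|t].
    by have [C hC] := kb (f n); exists C => t; rewrite mulN1r normrN; exact: hC.
  by rewrite MF mulN1r /= -normrN ler_norm.
by apply: le_trans h1; apply: qle => // t; rewrite MF ler_norm.
Unshelve. all: by end_near. Qed.

(** By the previous continuity only the vector [T f] of values at the first [n] points matters.
    Hahn-Banach on row vectors yields coefficients, and [z] is the combination of the [k i] with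
    them. *)
Let mean_near_point (q : (nat -> R) -> R) (e : R) : mean q -> 0 < e ->
  exists z, forall f (C : R), 0 <= C -> (forall x, `|f x| <= C * `|x|) ->
    `|q (f \o k) - f z| <= e * C.
Proof.
move=> qm e0; have [n hn] := mean_weak_star_continuous qm e0.
have [qD qZ qle qc] := qm.
(* If the absolute values at the first [n] points sum to at least [C / n.+1], this factor brings [p]
   up to the trivial bound [C * M] on the mean; otherwise [hn], applied to [f] scaled by [C^-1],
   bounds the mean by [e * C]. *)
pose K := n.+1%:R * M.
have K0 : 0 <= K by rewrite mulr_ge0// ltW.
pose p (v : 'rV[R]_n) := K * \sum_i `|v 0 i|.
have ps : sublinear p.
  split=> [v w|t v t0]; rewrite /p.
    rewrite -mulrDr ler_wpM2l// -big_split /= ler_sum// => i _.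
    by rewrite mxE ler_normD.
  rewrite mulrCA; congr (_ * _); rewrite mulr_sumr; apply: eq_bigr => i _.
  by rewrite mxE normrM ger0_norm.
pose T f : 'rV[R]_n := \row_i f (k i).
pose G v r := exists f, exists C : R, [/\ 0 <= C, forall x, `|f x| <= C * `|x|,
  v = T f & r <= q (f \o k) - e * C].
have Gc : convex_cone G.
  split.
  - have [f0 _ _] := norming_functional (0 : E); have [h hE] := dual_scaleP 0 f0.
    exists h, 0; split=> // [x||].
    + by rewrite hE !mul0r normr0.
    + by apply/rowP => i; rewrite !mxE hE mul0r.
    + rewrite mulr0 subr0 (_ : h \o k = fun=> 0) ?qc//.
      by apply/funext => t /=; rewrite hE mul0r.
  - move=> v w r s [f [C [C0 fC -> rf]]] [g [D [D0 gD -> sg]]].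
    have [h hE] := dual_addP f g; exists h, (C + D); split.
    + exact: addr_ge0.
    + by move=> x; rewrite hE mulrDl (le_trans (ler_normD _ _))// lerD.
    + by apply/rowP => i; rewrite !mxE hE.
    + rewrite (_ : h \o k = (f \o k) \+ (g \o k)) ?qD ?mulrDr ?opprD 1?addrACA ?lerD//.
      by apply/funext => t /=; rewrite hE.
  - move=> t v r t0 [f [C [C0 fC -> rf]]].
    have [h hE] := dual_scaleP t f; exists h, (t * C); split.
    + exact: mulr_ge0.
    + by move=> x; rewrite hE normrM ger0_norm// -mulrA ler_wpM2l.
    + by apply/rowP => i; rewrite !mxE hE.
    + rewrite (_ : h \o k = fun i => t * (f \o k) i); last first.
        by apply/funext => i /=; rewrite hE.
      by rewrite qZ// mulrCA -mulrBr ler_wpM2l.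
have Gp v r : G v r -> r <= p v.
  move=> [f [C [C0 fC -> rf]]]; apply: le_trans rf _.
  set s := \sum_i `|T f 0 i|.
  have s0 : 0 <= s by apply: sumr_ge0.
  have qf : `|q (f \o k)| <= C * M by apply: mean_norm_le => // t; exact: fk_le.
  have [Cs|sC] := leP (C / n.+1%:R) s.
    rewrite lerBlDr (le_trans (ler_norm _))// (le_trans qf)//.
    rewrite ler_wpDr ?mulr_ge0 ?(ltW e0)// /p -/s /K mulrAC ler_pM2r//.
    by rewrite mulrC -ler_pdivrMr.
  have {}C0 : 0 < C.
    by rewrite -(pmulr_lgt0 _ (x := n.+1%:R^-1)) ?invr_gt0// (le_lt_trans s0).
  have [h hE] := dual_scaleP C^-1 f.
  have hq : `|q (h \o k)| <= e.
    apply: hn => [x|i i_n].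
      by rewrite hE normrM gtr0_norm ?invr_gt0// ler_pdivrMl.
    rewrite hE normrM gtr0_norm ?invr_gt0// ler_pdivrMl// ltW//.
    apply: le_lt_trans sC; rewrite /s (bigD1 (Ordinal i_n))//= mxE lerDl.
    exact: sumr_ge0.
  have qE : q (f \o k) = C * q (h \o k).
    rewrite -qZ//; congr q; apply/funext => t /=.
    by rewrite hE mulrA divff ?gt_eqF// mul1r.
  apply: (@le_trans _ _ 0); last by rewrite mulr_ge0.
  rewrite subr_le0 qE mulrC ler_pM2r//; exact: le_trans (ler_norm _) hq.
have [g _ gG] := mazur_orlicz ps Gc Gp.
pose z := \sum_i g (delta_mx 0 i) *: k i.
have gT f : g (T f) = f z.
  rewrite [T f]row_sum_delta linear_sum /= /z /dual_fun linear_sum /=.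
  by apply: eq_bigr => i _; rewrite !linearZ mxE; exact: mulrC.
have half f C : 0 <= C -> (forall x, `|f x| <= C * `|x|) -> q (f \o k) - f z <= e * C.
  move=> C0 fC; rewrite lerBlDr addrC -lerBlDr -gT; apply: gG; by exists f, C.
exists z => f C C0 fC; rewrite ler_norml half// andbT.
have [h hE] := dual_scaleP (-1) f.
have := half h C C0; rewrite hE mulN1r (_ : h \o k = fun i => -1 * (f \o k) i); last first.
  by apply/funext => i /=; rewrite hE.
rewrite qZ// mulN1r lerNl opprB opprK addrC; apply => x.
by rewrite hE mulN1r normrN.
Qed.

(** Norming functionals make the approximate barycenters a Cauchy sequence, so completeness places
    the barycenter in [E] and not just in the bidual. *)
Lemma barycenter_exists (q : (nat -> R) -> R) : mean q ->
  exists z, forall f, f z = q (f \o k).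
Proof.
move=> qm; have /choice[z hz] : forall n : nat, exists z, forall f (C : R), 0 <= C ->
    (forall x, `|f x| <= C * `|x|) -> `|q (f \o k) - f z| <= n.+1%:R^-1 * C.
  by move=> n; apply: mean_near_point => //; rewrite invr_gt0.
have zz n m : `|z n - z m| <= n.+1%:R^-1 + m.+1%:R^-1.
  have [f f1 <-] := norming_functional (z n - z m).
  have f1' x : `|f x| <= 1 * `|x| by rewrite mul1r.
  have := hz n f 1 ler01 f1'; have := hz m f 1 ler01 f1'; rewrite dualB !mulr1.
  rewrite !ler_norml => /andP[h1 h2] /andP[h3 h4].
  by move: (n.+1%:R^-1) (m.+1%:R^-1) h2 h3 => a b; lra.
have [l hl] := cauchy_harmonic_cvg zz; exists l => f.
have [C C0 fC] := dual_bound f.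
apply/eqP; rewrite eq_sym -subr_eq0 -normr_le0; apply/ler_addgt0Pr => e e0.
have e1 : 0 < e / 2 / C by rewrite !divr_gt0.
have [n [h1 h2]] := hl _ e1.
have := hz n f C (ltW C0) fC => h3.
have -> : q (f \o k) - f l = (q (f \o k) - f (z n)) - f (l - z n).
  by rewrite dualB; ring.
rewrite add0r (le_trans (ler_normB _ _))// [leRHS]splitr lerD//.
  by apply: (le_trans h3); rewrite -ler_pdivlMr.
by apply: (le_trans (fC _)); rewrite mulrC -ler_pdivlMr.
Qed.

Definition barycenters : set E :=
  [set z | exists2 q, mean q & forall f, f z = q (f \o k)].

Lemma barycenters_range i : barycenters (k i).
Proof.
exists (fun g => g i) => //; split=> //.
Qed.

Lemma convex_barycenters : convex_set (barycenters : set (convex_lmodType E)).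
Proof.
apply/convex_setP => x y t [q qm qx] [q' qm' qy] /andP[t0 t1].
exists (fun g => t * q g + (1 - t) * q' g); last first.
  by move=> f; rewrite dualD !dualZ qx qy.
have [qD qZ qle qc] := qm; have [qD' qZ' qle' qc'] := qm'.
split=> [g h gb hb|c g gb|g h gb hb gh|c].
- by rewrite qD// qD'//; ring.
- by rewrite qZ// qZ'//; ring.
- by rewrite lerD// ler_wpM2l ?subr_ge0// ?qle ?qle'.
- by rewrite qc qc'; ring.
Qed.

(** Means are stable under pointwise limits along ultrafilters: the limit [L] of the representing
    means is a mean, and its barycenter is the weak limit sought. *)
Lemma weakly_compact_barycenters : weakly_compact barycenters.
Proof.
suff key (F : set_system E) : UltraFilter F -> F barycenters ->
    exists2 x, barycenters x & weak_lim F id x.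
  apply: ultra_weakly_compact => [F FU FB|F x FU FB Fx].
    by have [x _ Fx] := key F FU FB; exists x.
  by have [y By Fy] := key F FU FB; rewrite (weak_lim_unique Fx Fy).
move=> FU FB.
(* Off [barycenters], evaluation at 0 is taken, so that [Q x] is a mean for every [x]. *)
have /choice[Q hQ] : forall x, exists q : (nat -> R) -> R, mean q /\
    (barycenters x -> forall f, f x = q (f \o k)).
  move=> x; have [[q qm qx]|nB] := pselect (barycenters x); first by exists q.
  exists (fun g => g 0%N); split=> //; split=> //.
have /choice[L hL] : forall g : nat -> R, exists l : R, bounded_real_fun g ->
    (fun x => Q x g) @ F --> l.
  move=> g; have [[M' gM]|ng] := pselect (bounded_real_fun g); last by exists 0.
  have [x|l hl] := @ultra_bounded_cvg _ _ F (fun x => Q x g) M' FU; last by exists l.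
  exact: mean_norm_le (hQ x).1 gM.
have Lu g (l : R) : bounded_real_fun g -> (fun x => Q x g) @ F --> l -> L g = l.
  by move=> gb gl; apply: (cvg_unique _ (hL g gb) gl).
have Lm : mean L.
  split=> [g h gb hb|c g gb|g h gb hb gh|c].
  - apply: Lu; first by case: gb => [a ga]; case: hb => [b hb]; exists (a + b) => t;
      rewrite (le_trans (ler_normD _ _))// lerD.
    rewrite (_ : (fun x => _) = (fun x => Q x g + Q x h)); last first.
      by apply/funext => x; have [[qD _ _ _] _] := hQ x; rewrite qD.
    by apply: cvgD; exact: hL.
  - apply: Lu; first by case: gb => [a ga]; exists (`|c| * a) => t; rewrite normrM ler_wpM2l.
    rewrite (_ : (fun x => _) = (fun x => c * Q x g)); last first.
      by apply/funext => x; have [[_ qZ _ _] _] := hQ x; rewrite qZ.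
    by apply: cvgMr; exact: hL.
  - apply: (ler_cvg_to (hL g gb) (hL h hb)); apply: filterE => x.
    by have [[_ _ qle _] _] := hQ x; exact: qle.
  - apply: Lu; first by exists `|c|.
    rewrite (_ : (fun x => _) = (fun x => c)); first exact: cvg_cst.
    by apply/funext => x; have [[_ _ _ qc] _] := hQ x; rewrite qc.
have [z hz] := barycenter_exists Lm; exists z; first by exists L.
move=> f; rewrite hz; apply: cvg_trans (hL _ (kb f)).
apply: near_eq_cvg; apply: filterS FB => x Bx; by rewrite (hQ x).2.
Qed.

End Barycenter.

(* Krein's theorem, for sequences. *)
Lemma weakly_compact_convex_superset (k : nat -> E) (M : R) :
  (forall i, `|k i| <= M) -> ultra_weakly_cvg (range k) ->
  exists K, [/\ weakly_compact K, convex_set (K : set (convex_lmodType E)) & range k `<=` K].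
Proof.
move=> kM ku; have M1 : 0 < `|M| + 1 by rewrite ltr_wpDl.
have kM' i : `|k i| <= `|M| + 1.
  by apply: (le_trans (kM i)); rewrite ler_wpDr// ler_norm.
exists (barycenters k); split.
- exact: weakly_compact_barycenters kM' _.
- exact: convex_barycenters.
- by move=> _ [i _ <-]; exact: barycenters_range.
Qed.

End Krein.

(** * Sperner's lemma *)

Local Notation parity r g := (\big[addb/false]_(t <- r) g t).

Section Faces.
Context {T : eqType}.
Implicit Types (s : seq T) (g : seq T -> bool).

(** The boundary modulo 2: a chain is a list of simplices, evaluated against a test [g] by [parity].
    The empty simplex is a face of a point (augmented complex), which starts the induction in
    [sperner]. *)
Fixpoint faces {T} (s : seq T) : seq (seq T) :=
  if s is x :: s' then s' :: [seq x :: f | f <- faces s'] else [::].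

Lemma faces_map {T'} (h : T -> T') s : faces (map h s) = [seq map h f | f <- faces s].
Proof. by elim: s => [|x s IH] //=; rewrite IH -!map_comp. Qed.

Lemma size_faces s f : f \in faces s -> (size f).+1 = size s.
Proof.
elim: s f => [|x s IH] f //=; rewrite inE => /predU1P[->//|/mapP[f' /IH <- ->]].
by [].
Qed.

Lemma faces_subset s f : f \in faces s -> {subset f <= s}.
Proof.
elim: s f => [|x s IH] f //=; rewrite inE => /predU1P[->|/mapP[f' /IH fs ->]] z.
  by rewrite inE orbC => ->.
by rewrite !inE => /predU1P[->|/fs ->]; rewrite ?eqxx ?orbT.
Qed.

Lemma faces_missing s f : uniq s -> f \in faces s -> exists2 x, x \in s & x \notin f.
Proof.
elim: s f => [|x s IH] f //= /andP[xs us].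
rewrite inE => /predU1P[->|/mapP[f' /(IH _ us)[y ys yf] ->]].
  by exists x => //; rewrite inE eqxx.
exists y; first by rewrite inE ys orbT.
by rewrite inE negb_or yf andbT; apply: contraNneq xs => <-.
Qed.

(** Each face of codimension two is reached twice: the boundary squares to zero modulo 2. *)
Lemma parity_faces_faces s g : parity (faces s) (fun f => parity (faces f) g) = false.
Proof.
elim: s g => [|x s IH] g /=; first by rewrite big_nil.
rewrite big_cons big_map.
rewrite [X in _ (+) X](eq_bigr (fun f => g f (+) parity (faces f) (g \o cons x))).
  by rewrite big_split /= (IH (g \o cons x)) addbF addbb.
by move=> f _; rewrite big_cons big_map.
Qed.

Lemma parity_faces_rcons s x g :
  parity (faces (rcons s x)) g = g s (+) parity (faces s) (fun f => g (rcons f x)).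
Proof.
elim: s g => [|y s IH] g /=; first by rewrite big_cons !big_nil.
by rewrite !big_cons !big_map IH /= addbCA.
Qed.

Lemma parity_faces_rem s g : (forall s1 s2, perm_eq s1 s2 -> g s1 = g s2) ->
  parity (faces s) g = parity s (fun x => g (rem x s)).
Proof.
elim: s g => [|x s IH] g gp /=; first by rewrite !big_nil.
rewrite !big_cons big_map eqxx IH => [|s1 s2 s12]; last by apply: gp; rewrite perm_cons.
congr addb; rewrite !big_seq; apply: eq_bigr => y ys; apply: gp.
case: eqVneq => [->|//]; rewrite perm_sym; exact: perm_to_rem.
Qed.

End Faces.

(** Counting doors, the faces labelled [0, ..., m - 1]: a fully labelled simplex has one, a simplex
    with just these labels and one repetition has two, any other has none. *)
Lemma parity_faces_iota m (l : seq nat) : size l = m.+1 ->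
  (forall i, i \in l -> (i < m.+1)%N) ->
  parity (faces l) (fun u => perm_eq u (iota 0 m)) = perm_eq l (iota 0 m.+1).
Proof.
move=> lm l_lt; rewrite parity_faces_rem; last first.
  by move=> s1 s2 s12; rewrite (permPl s12).
have im : perm_eq (iota 0 m.+1) (m :: iota 0 m).
  by rewrite -addn1 iotaD /= add0n perm_sym -cat1s perm_catC.
have [/hasP[x xl xP]|/hasPn nP] :=
  boolP (has (fun x => perm_eq (rem x l) (iota 0 m)) l); last first.
  rewrite big_seq big1; last by move=> i /nP /negbTE.
  apply/esym/negbTE/negP => lp; have lm' := perm_trans lp im.
  have ml : m \in l by rewrite (perm_mem lm') inE eqxx.
  have /negP := nP m ml; apply; rewrite -(perm_cons m).
  by apply: perm_trans lm'; rewrite perm_sym; exact: perm_to_rem.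
have lx : perm_eq l (x :: iota 0 m).
  by apply: perm_trans (perm_to_rem xl) _; rewrite perm_cons.
have xm := l_lt _ xl.
have gE y : y \in l -> perm_eq (rem y l) (iota 0 m) = (y == x).
  move=> yl; rewrite -(perm_cons y) -(permPl (perm_to_rem yl)) (permPl lx).
  apply/idP/eqP => [h|->]; last exact: perm_refl.
  apply/eqP; move: h; case: eqVneq => // yx /permP /(_ (pred1 x)) /=.
  by rewrite eqxx (negbTE yx) add0n => /eqP; rewrite -[X in _ == X]add0n eqn_add2r.
rewrite big_seq (eq_bigr _ gE) -big_seq (perm_big _ lx) big_cons eqxx.
have -> : perm_eq l (iota 0 m.+1) = (x == m).
  rewrite (permPl lx) (permPr im).
  apply/idP/eqP => [h|->]; last exact: perm_refl.
  apply/eqP; move: h; case: eqVneq => // xm' /permP /(_ (pred1 m)) /=.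
  by rewrite eqxx (negbTE xm') add0n => /eqP; rewrite -[X in X == _]add0n eqn_add2r.
have -> : parity (iota 0 m) (fun y => y == x) = (x < m)%N.
  have := mem_iota 0 m x; rewrite add0n leq0n /= => <-.
  elim: (iota 0 m) (iota_uniq 0 m) => [|y s IH] /=; first by rewrite big_nil.
  move=> /andP[ys us]; rewrite big_cons IH// inE (eq_sym x).
  by case: (eqVneq y x) ys => [->|_] //= /negbTE ->.
by move: xm; rewrite ltnS leq_eqVlt; case: ltngtP.
Qed.

Section Subdivision.
Context {R : realType} {V : lmodType R}.
Implicit Types (s t : seq V) (Q : V -> Prop) (N : V -> R).

Definition barycenter s : V := (size s)%:R^-1 *: \sum_(x <- s) x.

(** Barycentric subdivision: the subdivided boundary is coned from the barycenter. The fuel [n] is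
    meant to be [size s]. *)
Fixpoint subdivision n s : seq (seq V) :=
  if n is n'.+1 then
    [seq barycenter s :: t | t <- flatten [seq subdivision n' f | f <- faces s]]
  else [:: [::]].

Fixpoint iter_subdivision k s : seq (seq V) :=
  if k is k'.+1 then
    flatten [seq subdivision (size t) t | t <- iter_subdivision k' s]
  else [:: s].

Lemma iter_subdivisionS k s : iter_subdivision k.+1 s =
  flatten [seq subdivision (size t) t | t <- iter_subdivision k s].
Proof. by []. Qed.

Lemma parity_flatten {T T' : Type} (c : seq T) (h : T -> seq T') (g : T' -> bool) :
  parity (flatten (map h c)) g = parity c (fun x => parity (h x) g).
Proof. by rewrite big_flatten big_map. Qed.

(** Subdivision is a chain map. The boundary of the cone consists of its base and of the cone over
    the boundary of the base; the latter cancels by induction and [parity_faces_faces]. *)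
Lemma parity_subdivision n s g : size s = n.+1 ->
  parity (subdivision n.+1 s) (fun t => parity (faces t) g) =
  parity (faces s) (fun f => parity (subdivision n f) g).
Proof.
elim: n s g => [|n IH] s g sn.
  case: s sn => [|x [|y s]] //= _.
  by rewrite !big_cons !big_nil.
rewrite [subdivision n.+2 s]/= -/(subdivision n.+1) big_map parity_flatten.
under eq_bigr do under eq_bigr do rewrite /= big_cons big_map.
under eq_bigr do rewrite big_split.
rewrite big_split /= [X in _ (+) X](_ : _ = false) ?addbF//.
rewrite big_seq (eq_bigr (fun f => parity (faces f)
    (fun f' => parity (subdivision n f') (fun t => g (barycenter s :: t))))) -?big_seq.
  exact: parity_faces_faces.
move=> f /size_faces; rewrite sn => -[fn].
by rewrite -(IH f (fun t => g (barycenter s :: t)) fn).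
Qed.

Lemma size_subdivision n s t : size s = n -> t \in subdivision n s -> size t = n.
Proof.
elim: n s t => [|n IH] s t sn /=; first by rewrite inE => /eqP ->.
move=> /mapP[t' /flattenP[c /mapP[f fs ->] t'c] ->] /=; congr _.+1.
by apply: IH t'c; have := size_faces fs; rewrite sn => -[].
Qed.

Lemma size_iter_subdivision k s t : t \in iter_subdivision k s -> size t = size s.
Proof.
elim: k t => [|k IH] t /=; first by rewrite inE => /eqP ->.
by move=> /flattenP[c /mapP[u /IH us ->] tu]; rewrite -us; exact: size_subdivision tu.
Qed.

Lemma parity_iter_subdivision k s g : s != [::] ->
  parity (iter_subdivision k s) (fun t => parity (faces t) g) =
  parity (faces s) (fun f => parity (iter_subdivision k f) g).
Proof.
move=> s0; elim: k g => [|k IH] g.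
  by rewrite /= big_seq1; apply: eq_bigr => f _; rewrite big_seq1.
rewrite iter_subdivisionS parity_flatten big_seq
  [LHS](eq_bigr (fun t => parity (faces t) (fun f => parity (subdivision (size f) f) g))).
  rewrite -big_seq (IH (fun f => parity (subdivision (size f) f) g)); apply: eq_bigr => f _.
  by rewrite iter_subdivisionS parity_flatten.
move=> t /size_iter_subdivision ts; have t0 : (0 < size t)%N by rewrite ts lt0n size_eq0.
rewrite -(prednK t0) parity_subdivision ?prednK// !big_seq; apply: eq_bigr => f ft.
by have := size_faces ft; rewrite -{1}(prednK t0) => -[->].
Qed.

Definition convex_pred Q := forall x y (a : R), Q x -> Q y -> 0 <= a <= 1 ->
  Q (a *: x + (1 - a) *: y).

Lemma convex_barycenter Q s : convex_pred Q -> s != [::] -> (forall x, x \in s -> Q x) ->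
  Q (barycenter s).
Proof.
move=> Qc; elim: s => [//|x s IH] _ Qs.
have Qx : Q x by apply: Qs; rewrite inE eqxx.
case: (eqVneq s [::]) => [->|s0].
  by rewrite /barycenter big_seq1 invr1 scale1r.
have Qb : Q (barycenter s) by apply: IH => // y ys; apply: Qs; rewrite inE ys orbT.
pose a : R := (size s).+1%:R^-1.
have a01 : 0 <= a <= 1 by rewrite invr_ge0 ler0n invf_le1//= ler1n.
have -> : barycenter (x :: s) = a *: x + (1 - a) *: barycenter s; last exact: Qc.
rewrite /barycenter big_cons scalerDr scalerA; congr (_ + _ *: _).
have ss : (size s)%:R != 0 :> R by rewrite pnatr_eq0 size_eq0.
by rewrite /a /= -natr1; field; rewrite ss natr1 pnatr_eq0.
Qed.

(** Takes the place of convex hulls: a suitable convex [Q] records supports, mesh bounds or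
    membership in [K]. *)
Lemma convex_subdivision Q n s : convex_pred Q -> size s = n -> (forall x, x \in s -> Q x) ->
  forall t, t \in subdivision n s -> forall x, x \in t -> Q x.
Proof.
move=> Qc; elim: n s => [|n IH] s sn Qs t /=; first by rewrite inE => /eqP ->.
move=> /mapP[t' /flattenP[c /mapP[f fs ->] t'c] ->] x.
rewrite inE => /predU1P[->|xt'].
  by apply: convex_barycenter => //; rewrite -size_eq0 sn.
apply: (IH f _ _ t' t'c x xt'); first by have := size_faces fs; rewrite sn => -[].
by move=> y /(faces_subset fs); exact: Qs.
Qed.

Lemma convex_iter_subdivision Q k s : convex_pred Q -> (forall x, x \in s -> Q x) ->
  forall t, t \in iter_subdivision k s -> forall x, x \in t -> Q x.
Proof.
move=> Qc Qs; elim: k => [|k IH] t /=; first by rewrite inE => /eqP ->.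
move=> /flattenP[c /mapP[u uk ->] tu]; apply: (convex_subdivision Qc erefl _ tu).
exact: IH.
Qed.

Definition seminorm N := (forall x y, N (x + y) <= N x + N y) /\
  (forall a x, N (a *: x) = `|a| * N x).

(** The vector [barycenter s - w] averages the differences [x - w], one of which vanishes, whence
    the contraction ratio; convexity carries the bound to the vertices of a subdivided face. The
    bound [m] gives one ratio for all dimensions. *)
Lemma mesh_subdivision N n m s (d : R) : seminorm N -> (n <= m.+1)%N -> size s = n ->
  0 <= d -> (forall x y, x \in s -> y \in s -> N (x - y) <= d) ->
  forall t, t \in subdivision n s -> forall x y, x \in t -> y \in t ->
    N (x - y) <= (1 - m.+1%:R^-1) * d.
Proof.
move=> [ND NZ] + + d0.
have N0 : N 0 = 0 by rewrite -(scale0r 0) NZ normr0 mul0r.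
have NN x : N (- x) = N x by rewrite -scaleN1r NZ normrN1 mul1r.
have r0 : 0 <= (1 - m.+1%:R^-1) * d.
  by rewrite mulr_ge0// subr_ge0 invf_le1// ler1n.
elim: n s => [|n IH] s nm sn sd t /=; first by rewrite inE => /eqP ->.
move=> /mapP[t' /flattenP[c /mapP[f fs ->] t'c] ->] x y.
have fn : size f = n by have := size_faces fs; rewrite sn => -[].
have key z : z \in t' -> N (barycenter s - z) <= (1 - m.+1%:R^-1) * d.
  move=> zt'; pose Q w := N (barycenter s - w) <= (1 - m.+1%:R^-1) * d.
  apply: (@convex_subdivision Q n f _ fn _ t' t'c z zt').
    move=> u v a Qu Qv /andP[a0 a1]; rewrite /Q.
    have -> : barycenter s - (a *: u + (1 - a) *: v) =
        a *: (barycenter s - u) + (1 - a) *: (barycenter s - v).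
      by rewrite !scalerBr addrACA -scalerDl (addrC a) subrK scale1r opprD.
    rewrite (le_trans (ND _ _))// !NZ (ger0_norm a0) ger0_norm ?subr_ge0//.
    have -> : (1 - m.+1%:R^-1) * d = a * ((1 - m.+1%:R^-1) * d) +
       (1 - a) * ((1 - m.+1%:R^-1) * d) by rewrite -mulrDl (addrC a) subrK mul1r.
    by rewrite lerD// ler_wpM2l// subr_ge0.
  move=> w wf; have ws := faces_subset fs wf; rewrite /Q.
  have -> : barycenter s - w = n.+1%:R^-1 *: \sum_(x <- s) (x - w).
    rewrite /barycenter sn big_split /= scalerDr; congr (_ + _).
    rewrite big_const_seq count_predT sn iter_addr_0
      -[(- w) *+ _]scaler_nat scalerA mulVf ?scale1r//.
  rewrite NZ ger0_norm ?invr_ge0//.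
  have Nsum : N (\sum_(x <- s) (x - w)) <= n%:R * d.
    rewrite (perm_big _ (perm_to_rem ws)) big_cons subrr /= add0r.
    have -> : n = size (rem w s) by rewrite size_rem// sn.
    have : forall z, z \in rem w s -> N (z - w) <= d by move=> z' /mem_rem z's; exact: sd.
    elim: (rem w s) => [|z' l IHl] hl; first by rewrite big_nil N0 mul0r.
    rewrite big_cons (le_trans (ND _ _))// -natr1 mulrDl mul1r addrC lerD//.
      by apply: IHl => z'' z''l; apply: hl; rewrite inE z''l orbT.
    by apply: hl; rewrite inE eqxx.
  apply: (@le_trans _ _ (n.+1%:R^-1 * (n%:R * d))); first by rewrite ler_wpM2l// invr_ge0.
  rewrite mulrA ler_wpM2r//.
  have -> : n.+1%:R^-1 * n%:R = 1 - n.+1%:R^-1 :> R.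
    have h : n.+1%:R != 0 :> R by rewrite pnatr_eq0.
    by apply: (mulfI h); rewrite mulrA divff// mul1r mulrBr divff// mulr1 -natr1 addrK.
  by rewrite lerB// lef_pV2 ?posrE// ler_nat.
rewrite !inE => /predU1P[->|xt] /predU1P[->|yt].
- by rewrite subrr N0.
- exact: key.
- by rewrite -NN opprB key.
- apply: (IH f _ fn _ t' t'c) => //; first exact: ltnW.
  by move=> u v /(faces_subset fs) us /(faces_subset fs) vs; exact: sd.
Qed.

Lemma mesh_iter_subdivision N k m s (d : R) : seminorm N -> (size s <= m.+1)%N ->
  0 <= d -> (forall x y, x \in s -> y \in s -> N (x - y) <= d) ->
  forall t, t \in iter_subdivision k s -> forall x y, x \in t -> y \in t ->
    N (x - y) <= (1 - m.+1%:R^-1) ^+ k * d.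
Proof.
move=> Ns sm d0 sd; elim: k => [|k IH] t /=.
  by rewrite inE => /eqP -> x y xs ys; rewrite expr0 mul1r sd.
move=> /flattenP[c /mapP[u uk ->] tu]; rewrite exprS -mulrA.
apply: (mesh_subdivision Ns _ erefl _ _ tu).
- by rewrite (size_iter_subdivision uk).
- by rewrite mulr_ge0// exprn_ge0// subr_ge0 invf_le1// ler1n.
- exact: IH.
Qed.

(** Counting doors over all small simplices leaves, modulo 2, those on the boundary. The face
    opposite the last vertex contributes an odd number by induction; every other face misses a label
    below the last one and has no door. *)
Lemma sperner (v : nat -> V) (l : V -> nat) k m :
  (forall u : seq nat, {subset u <= iota 0 m} ->
    forall t, t \in iter_subdivision k (map v u) -> forall x, x \in t -> l x \in u) ->
  parity (iter_subdivision k (map v (iota 0 m))) (fun t => perm_eq (map l t) (iota 0 m)).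
Proof.
have iter0 : iter_subdivision k [::] = [:: [::]] by elim: k => //= k ->.
elim: m => [|m IH] h.
  by rewrite /= iter0 big_seq1.
rewrite big_seq (eq_bigr (fun t => parity (faces t)
    (fun u => perm_eq (map l u) (iota 0 m)))) -?big_seq; last first.
  move=> t tk; rewrite -parity_faces_iota ?faces_map ?big_map//.
    by rewrite size_map (size_iter_subdivision tk) size_map size_iota.
  move=> _ /mapP[x xt ->]; have := h _ (fun _ => id) t tk x xt.
  by rewrite mem_iota add0n.
rewrite parity_iter_subdivision // faces_map big_map.
have -> : iota 0 m.+1 = rcons (iota 0 m) m by rewrite -cats1 -addn1 iotaD add0n.
have sub u : {subset u <= iota 0 m} -> {subset u <= iota 0 m.+1}.
  by move=> um i /um; rewrite !mem_iota !add0n => /= /ltnW.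
rewrite parity_faces_rcons IH /=; last by move=> u um; exact/h/sub.
rewrite big_seq big1// => f fm; rewrite big_seq big1// => t tf; apply/negbTE/negP => tp.
have [i im iF] := faces_missing (iota_uniq 0 m) fm.
have : i \in map l t by rewrite (perm_mem tp).
move=> /mapP[x xt ix].
have := h (rcons f m) _ t tf x xt; rewrite -ix mem_rcons inE (negbTE iF) orbF => -/(_ _)/eqP.
move=> im'; have : i = m.
  apply: im' => j; rewrite mem_rcons inE => /predU1P[->|/(faces_subset fm)].
    by rewrite mem_iota add0n leqnn.
  by rewrite !mem_iota !add0n => /= /ltnW.
by move=> e; move: im; rewrite e mem_iota add0n ltnn andbF.
Qed.

End Subdivision.

(** * KKM lemma and countable hulls *)

(** The [G j] are not assumed closed, so the vertices of a small fully labelled simplex, one in each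
    [G j], replace a common point. *)
Lemma kkm_approx (R : realType) (E : normedModType R) (n : nat) (y : nat -> E)
  (K : E -> Prop) (G : nat -> E -> Prop) (e : R) :
  0 < e -> convex_pred K -> (forall i, (i < n.+1)%N -> K (y i)) ->
  (forall p : nat -> R, (forall i, 0 <= p i) -> \sum_(i < n.+1) p i = 1 ->
    exists j, [/\ (j < n.+1)%N, 0 < p j & G j (\sum_(i < n.+1) p i *: y i)]) ->
  exists x : nat -> E, forall j, (j < n.+1)%N ->
    [/\ K (x j), G j (x j) & `|x j - x 0%N| <= e].
Proof.
(* The subdivision is made in the space of coefficients: labels need well-defined coordinates, and
   the [y i] may be dependent. Distances are pulled back along [X], which gives only a seminorm. *)
move=> e0 Kc Ky H; pose V : lmodType R := nat -> R^o.
pose X (p : V) := \sum_(i < n.+1) p i *: y i.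
have XD p q : X (p + q) = X p + X q.
  by rewrite /X -big_split /=; apply: eq_bigr => i _; rewrite -scalerDl.
have XZ a p : X (a *: p) = a *: X p.
  by rewrite /X scaler_sumr; apply: eq_bigr => i _; rewrite scalerA.
pose N p := `|X p|.
have Ns : seminorm N.
  by split=> [p q|a p]; rewrite /N ?XD ?ler_normD// XZ normrZ.
pose v i : V := fun j => (j == i)%:R.
have Xv i : (i < n.+1)%N -> X (v i) = y i.
  move=> i_n; rewrite /X (bigD1 (Ordinal i_n))//= /v eqxx scale1r big1 ?addr0// => j ji.
  by rewrite (negbTE (_ : val j != i)) ?scale0r.
pose D (p : V) := (forall i, 0 <= p i) /\ \sum_(i < n.+1) p i = 1.
have Dc : convex_pred D.
  move=> p q a [p0 p1] [q0 q1] /andP[a0 a1]; split=> [i|].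
    by rewrite addr_ge0// mulr_ge0// ?subr_ge0.
  rewrite big_split /= -!mulr_sumr p1 q1; ring.
have Dv i : (i < n.+1)%N -> D (v i).
  move=> i_n; split=> [j|]; first exact: ler0n.
  rewrite (bigD1 (Ordinal i_n))//= /v eqxx big1 ?addr0// => j ji.
  by rewrite (negbTE (_ : val j != i)).
have /choice[l hl] : forall p : V, exists j, D p ->
    [/\ (j < n.+1)%N, 0 < p j & G j (X p)].
  move=> p; have [[p0 p1]|nD] := pselect (D p); last by exists 0%N.
  by have [j jH] := H p p0 p1; exists j.
pose s := map v (iota 0 n.+1).
have s_lt x : x \in s -> exists2 i, (i < n.+1)%N & x = v i.
  by move=> /mapP[i]; rewrite mem_iota add0n => /andP[_ i_n] ->; exists i.
pose d := \sum_(p <- s) \sum_(q <- s) N (p - q).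
have sum_ge (F : V -> R) (r : seq V) x : (forall p, 0 <= F p) -> x \in r ->
    F x <= \sum_(p <- r) F p.
  move=> F0; elim: r => [//|z r IH]; rewrite inE big_cons => /predU1P[->|xr].
    by rewrite lerDl sumr_ge0.
  by rewrite ler_wpDl// IH.
have sd p q : p \in s -> q \in s -> N (p - q) <= d.
  move=> ps qs; apply: (@le_trans _ _ (\sum_(q <- s) N (p - q))).
    by apply: (sum_ge (fun q => N (p - q))) => // z; exact: normr_ge0.
  apply: (sum_ge (fun p => \sum_(q <- s) N (p - q))) => // z.
  by apply: sumr_ge0 => w _; exact: normr_ge0.
have d0 : 0 <= d by apply: sumr_ge0 => p _; apply: sumr_ge0 => q _; exact: normr_ge0.
have [k hk] : exists k, (1 - n.+2%:R^-1) ^+ k * d <= e.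
  have r1 : `|1 - n.+2%:R^-1 : R| < 1.
    have i0 : 0 < n.+2%:R^-1 :> R by rewrite invr_gt0.
    have i1 : n.+2%:R^-1 <= 1 :> R by rewrite invf_le1 ?ler1n.
    by rewrite ger0_norm ?subr_ge0// ltrBlDr ltrDl.
  have /cvgrPdist_lt/(_ (e / (d + 1))) := cvg_expr r1.
  have d1 : 0 < d + 1 by rewrite ltr_wpDl.
  rewrite divr_gt0// => /(_ isT)[k _ /(_ k (leqnn k))].
  rewrite /= sub0r normrN => h; exists k.
  apply: (@le_trans _ _ (e / (d + 1) * d)).
    rewrite ler_wpM2r//; apply: le_trans (ltW h); exact: ler_norm.
  rewrite mulrAC ler_pdivrMr// ler_pM2l// lerDl//.
have tD (u : seq nat) : {subset u <= iota 0 n.+1} ->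
    forall t, t \in iter_subdivision k (map v u) -> forall x, x \in t -> D x.
  move=> us; apply: convex_iter_subdivision => // x /mapP[i /us].
  by rewrite mem_iota add0n => /andP[_ i_n] ->; exact: Dv.
have par : \big[addb/false]_(t <- iter_subdivision k s) perm_eq (map l t) (iota 0 n.+1).
  (* On the face spanned by [u] the coordinates outside [u] vanish, whereas the coordinate named by
     the label is positive. *)
  apply: sperner => u us t tk x xt; have [lx p0 _] := hl x (tD u us t tk x xt).
  apply: contraLR p0 => lu; rewrite -leNgt.
  pose Q (p : V) := p (l x) = 0.
  have -> : x (l x) = 0; last by [].
  apply: (@convex_iter_subdivision _ V Q k (map v u) _ _ t tk x xt) => [p q a pQ qQ _|p].
    have -> : Q (a *: p + (1 - a) *: q) = (a * p (l x) + (1 - a) * q (l x) = 0) by [].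
    by rewrite pQ qQ !mulr0 addr0.
  move=> /mapP[i iu ->]; rewrite /Q /v; case: eqVneq => // lxi.
  by move: lu; rewrite lxi iu.
have [t tk tp] : exists2 t, t \in iter_subdivision k s & perm_eq (map l t) (iota 0 n.+1).
  apply: contrapT => nt; move: par.
  rewrite big_seq big1// => t tk; apply/negbTE/negP => tp; apply: nt; by exists t.
have tDx x : x \in t -> D x by apply: tD tk x.
have /choice[x hx] : forall j, exists x : V, (j < n.+1)%N -> x \in t /\ l x = j.
  move=> j; have [jn|jn] := boolP (j < n.+1)%N; last by exists 0.
  have : j \in map l t by rewrite (perm_mem tp) mem_iota.
  by move=> /mapP[x xt ->]; exists x.
exists (X \o x) => j jn; have [xt lx] := hx j jn; split.
- apply: (@convex_iter_subdivision _ V (K \o X) k s _ _ t tk _ xt) => [p q a pQ qQ a01|p].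
    by rewrite /= XD !XZ; exact: Kc.
  by move=> /s_lt[i i_n ->] /=; rewrite Xv//; exact: Ky.
- by have [_ _] := hl _ (tDx _ xt); rewrite lx.
- have [xt0 _] := hx 0%N isT.
  apply: le_trans hk; rewrite /= -scaleN1r -XZ -XD scaleN1r.
  apply: (mesh_iter_subdivision Ns _ d0 sd tk) => //.
  by rewrite size_map size_iota.
Qed.

Section DenseHull.
Context {R : realType} {E : normedModType R}.
Implicit Types (A : set E) (x y : E).

Lemma closure_normP A x : closure A x <-> forall e : R, 0 < e -> exists2 a, A a & `|x - a| <= e.
Proof.
split=> [clx e e0|h B /nbhs_ballP[e /= e0 eB]].
  have [a [Aa]] := clx _ (nbhsx_ballx x e e0).
  by rewrite -ball_normE /= => /ltW xa; exists a.
have e20 : 0 < e / 2 by rewrite divr_gt0.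
have [a Aa xa] := h _ e20; exists a; split=> //; apply: eB.
by rewrite -ball_normE /=; apply: le_lt_trans xa _; rewrite ltr_pdivrMr// mulr_natr mulr2n ltrDl.
Qed.

Lemma convex_combinationB (t : R) x y x' y' :
  (t *: x + (1 - t) *: y) - (t *: x' + (1 - t) *: y') = t *: (x - x') + (1 - t) *: (y - y').
Proof. by rewrite opprD addrACA !scalerBr. Qed.

Lemma convex_combinationE (t : R) x y : t *: x + (1 - t) *: y = y + t *: (x - y).
Proof. by rewrite scalerBl scale1r scalerBr addrCA. Qed.

(** Finite stages keep the union countable. Their coefficients, with growing denominators, become
    dense in the unit interval, so the closure of the union is convex even if the union is not. *)
Fixpoint hull_stage (s : nat -> E) (f : E -> E) n : seq E :=
  if n is n'.+1 then let L := hull_stage s f n' in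
    L ++ s n' :: map f L ++ flatten [seq flatten [seq [seq
      ((k%:R / n'.+1%:R) *: x + (1 - k%:R / n'.+1%:R) *: y) | k <- iota 0 n'.+2]
      | x <- L] | y <- L]
  else [::].

Lemma dense_hull (s : nat -> E) (f : E -> E) : exists d : nat -> E,
  [/\ range s `<=` range d,
      forall x, range d x -> range d (f x),
      convex_set (closure (range d) : set (convex_lmodType E))
    & forall Q : E -> Prop, convex_pred Q -> range s `<=` Q ->
        (forall x, range d x -> Q x -> Q (f x)) -> range d `<=` Q].
Proof.
pose L := hull_stage s f.
(* An index codes a stage and a position in it; all other indices give [s 0], which is in stage
   1. *)
pose d i := if unpickle i is Some (n, m) then nth (s 0%N) (L n) m else s 0%N.
have Lmono n m x : (n <= m)%N -> x \in L n -> x \in L m.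
  move=> /subnK <-; elim: (m - n)%N => [//|p IH] /IH xp.
  by rewrite addSn /= mem_cat xp.
have sL n : s n \in L n.+1 by rewrite /= mem_cat inE eqxx orbT.
have dP x : range d x <-> exists n, x \in L n.
  split=> [[i _ <-]|[n xn]].
    rewrite /d; case: unpickle => [[n m]|]; last by exists 1%N.
    have [mn|mn] := ltnP m (size (L n)); first by exists n; exact: mem_nth.
    by exists 1%N; rewrite nth_default.
  exists (pickle (n, index x (L n))) => //.
  by rewrite /d pickleK nth_index.
have Lc n m k x y : x \in L n -> y \in L n -> (n <= m)%N -> (k <= m.+1)%N ->
    (k%:R / m.+1%:R) *: x + (1 - k%:R / m.+1%:R) *: y \in L m.+1.
  move=> xn yn nm km; rewrite /= mem_cat inE mem_cat; apply/orP; right; apply/orP; right.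
  apply/orP; right; apply/flattenP; eexists; first by apply/mapP; exists y; [exact: Lmono yn|].
  apply/flattenP; eexists; first by apply/mapP; exists x; [exact: Lmono xn|].
  by apply/mapP; exists k => //; rewrite mem_iota add0n.
exists d; split.
- by move=> _ [n _ <-]; apply/dP; exists n.+1.
- move=> x /dP[n xn]; apply/dP; exists n.+1.
  by rewrite /= mem_cat inE mem_cat map_f ?orbT.
- apply/convex_setP => x y t /closure_normP cx /closure_normP cy /andP[t0 t1].
  apply/closure_normP => e e0; have e20 : 0 < e / 2 by rewrite divr_gt0.
  have [x' /dP[n x'n] xx'] := cx _ e20; have [y' /dP[n' y'n] yy'] := cy _ e20.
  (* A stage containing both points, so late that rounding [t] to a multiple of [1 / m.+1] moves the
     combination by at most [e / 2]. *)
  have [m /= m1 m2] : exists2 m, (maxn n n' <= m)%N & `|x' - y'| / m.+1%:R <= e / 2.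
    have c0 : 0 < `|x' - y'| + 1 by rewrite ltr_wpDl.
    have [N _ HN] := near_harmonic (divr_gt0 e20 c0).
    exists (maxn N (maxn n n')); first exact: leq_maxr.
    have := HN _ (leq_maxl N (maxn n n')); rewrite /= ler_pdivlMr// => h.
    apply: le_trans h; rewrite mulrC ler_pM2l ?invr_gt0//.
    by rewrite lerDl.
  pose k := Num.truncn (t * m.+1%:R); pose r : R := k%:R / m.+1%:R.
  have tm0 : 0 <= t * m.+1%:R by rewrite mulr_ge0.
  have /andP[k1 k2] := truncn_itv tm0; rewrite -/k in k1 k2.
  have km : (k <= m.+1)%N.
    by rewrite -(ler_nat R) (le_trans k1)// ler_piMl.
  have rt : `|t - r| <= m.+1%:R^-1.
    have rt : r <= t by rewrite /r ler_pdivrMr.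
    rewrite ger0_norm ?subr_ge0// lerBlDl -[X in X + _]/(k%:R / m.+1%:R).
    rewrite -[X in _ + X]mul1r -mulrDl ler_pdivlMr//.
    by apply: le_trans (ltW k2) _; rewrite -natr1.
  exists (r *: x' + (1 - r) *: y').
    apply/dP; exists m.+1; apply: (Lc m) => //.
      by apply: Lmono x'n; rewrite (leq_trans _ m1)// leq_maxl.
    by apply: Lmono y'n; rewrite (leq_trans _ m1)// leq_maxr.
  have -> : t *: x + (1 - t) *: y - (r *: x' + (1 - r) *: y') =
     (t *: (x - x') + (1 - t) *: (y - y')) + (t - r) *: (x' - y').
    rewrite -convex_combinationB; set z := _ *: (x' - y').
    have -> : z = t *: x' + (1 - t) *: y' - (r *: x' + (1 - r) *: y').
      by rewrite !convex_combinationE opprD addrACA subrr add0r -scalerBl.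
    by rewrite subrKA.
  rewrite (le_trans (ler_normD _ _))// [leRHS]splitr lerD//.
    rewrite (le_trans (ler_normD _ _))// !normrZ (ger0_norm t0) ger0_norm ?subr_ge0//.
    have -> : e / 2 = t * (e / 2) + (1 - t) * (e / 2) by ring.
    by rewrite lerD// ler_wpM2l// subr_ge0.
  rewrite normrZ; apply: le_trans m2; rewrite mulrC; exact: ler_wpM2l.
- move=> Q Qc Qs Qf x /dP[n]; elim: n x => [//|n IH] x /=.
  rewrite mem_cat inE mem_cat => /or4P[/IH//|/eqP ->|/mapP[z zn ->]|].
  + by apply: Qs; exists n.
  + by apply: Qf; [apply/dP; exists n|exact: IH].
  + move=> /flattenP[_ /mapP[z zn ->] /flattenP[_ /mapP[w wn ->] /mapP[k kn ->]]].
    apply: Qc; [exact: IH|exact: IH|]; rewrite divr_ge0//= ler_pdivrMr// mul1r ler_nat.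
    by move: kn; rewrite mem_iota add0n ltnS.
Qed.

End DenseHull.

(** * Kakutani's theorem for weakly compact sets *)

Section Subsequences.
Context {R : realType} {E : normedModType R}.
Implicit Types (f : dual E) (A K M W : set E) (x y z : E) (s d : nat -> E).

Definition separates (h : nat -> dual E) W :=
  forall x y, W x -> W y -> (forall n, h n x = h n y) -> x = y.

(** Functionals norming the differences [d i - d j] suffice: for [d i] near [x] and [d j] near [y],
    agreement at [x] and [y] forces [d i - d j] to be small. *)
Lemma separable_separates d : exists h, separates h (closure (range d)).
Proof.
have /choice[g hg] : forall ij : nat * nat, exists f,
    (forall y, `|f y| <= `|y|) /\ f (d ij.1 - d ij.2) = `|d ij.1 - d ij.2|.
  by move=> ij; have [f f1 f2] := norming_functional (d ij.1 - d ij.2); exists f.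
pose h n := if unpickle n is Some ij then g ij else g (0%N, 0%N).
exists h => x y /closure_normP cx /closure_normP cy hxy.
apply/eqP; rewrite -subr_eq0 -normr_le0; apply/ler_addgt0Pr => e e0; rewrite add0r.
have e40 : 0 < e / 4 by rewrite divr_gt0.
have [_ [i _ <-] xi] := cx _ e40; have [_ [j _ <-] yj] := cy _ e40.
have [g1 g2] := hg (i, j); rewrite /= in g2.
have gxy : g (i, j) x = g (i, j) y.
  by have := hxy (pickle (i, j)); rewrite /h pickleK.
have := g1 (x - d i); have := g1 (y - d j); rewrite !dualB !ler_norml.
move: g2; rewrite dualB => g2 /andP[a1 a2] /andP[b1 b2].
have -> : x - y = (x - d i) + (d i - d j) - (y - d j).
  by rewrite subrKA opprB subrKA.
have := ler_normB (x - d i + (d i - d j)) (y - d j).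
have := ler_normD (x - d i) (d i - d j); lra.
Qed.

(** Along each free ultrafilter [s] has a weak limit in [W], which the [h j] identify as [x]; thus
    countably many functionals decide weak convergence. *)
Lemma weak_lim_separates s h W x : W x -> separates h W ->
  (forall V : set_system nat, UltraFilter V -> \oo `<=` V ->
    exists2 z, W z & weak_lim V s z) ->
  (forall j, h j (s n) @[n --> \oo] --> h j x) -> weak_lim \oo s x.
Proof.
move=> Wx hW sW hs f; apply: cvgn_ultra => V VU ooV.
have [z Wz sz] := sW V VU ooV; suff -> : x = z by exact: sz.
apply: hW => // j; have hx : h j (s n) @[n --> V] --> h j x.
  by move=> B Bx; exact: (ooV _ (hs j B Bx)).
exact: (cvg_unique _ hx (sz (h j))).
Qed.

(** Members of [V] are returned rather than a subsequence, so that extractions for several sequences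
    can be intersected. *)
Lemma weak_lim_ultra_extract s (V : set_system nat) x : UltraFilter V ->
  ultra_weakly_cvg (range s) -> weak_lim V s x ->
  exists P : nat -> set nat, (forall n, V (P n)) /\
    forall i_ : nat -> nat, (forall n, P n (i_ n)) -> weak_lim \oo (s \o i_) x.
Proof.
(* The closure of the hull of [s] is convex and separable, hence contains the weak limits of [s] and
   is separated by countably many functionals. *)
move=> VU su sx; have [d [sd _ dc _]] := dense_hull s id.
have [h hd] := separable_separates d; set W := closure (range d) in dc hd.
have sW (V' : set_system nat) (i_ : nat -> nat) z : UltraFilter V' ->
    weak_lim V' (s \o i_) z -> W z.
  move=> V'U; apply: weak_lim_closed_convex; [exact: closed_closure|exact: dc|].
  apply: filterE => n; apply: subset_closure; apply: sd; by exists (i_ n).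
have ek n : 0 < n.+1%:R^-1 :> R by rewrite invr_gt0.
pose P n := [set i | forall j, (j < n)%N -> `|h j x - h j (s i)| <= n.+1%:R^-1].
exists P; split=> [n|i_ iP].
  suff : forall m, V [set i | forall j, (j < m)%N -> `|h j x - h j (s i)| <= n.+1%:R^-1].
    exact.
  elim=> [|m IH]; first by apply: filterE.
  have /cvgrPdist_le/(_ _ (ek n)) := sx (h m).
  apply: filterS2 IH => i IH hi j; rewrite ltnS leq_eqVlt => /predU1P[->//|]; exact: IH.
apply: (@weak_lim_separates _ h W) => //.
- exact: (sW V id).
- move=> V' V'U _; have [|z sz] := ultra_weakly_cvg_fam su V'U (s := s \o i_).
    by apply: filterE => n; exists (i_ n).
  by exists z => //; exact: sW sz.
- move=> j; apply/cvgrPdist_le => e e0.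
  near=> n; apply: (@le_trans _ _ n.+1%:R^-1); last by near: n; exact: near_harmonic.
  by apply: iP; near: n; exists j.+1.
Unshelve. all: by end_near. Qed.

Lemma ultra_choice (V : set_system nat) (P : nat -> set nat) : UltraFilter V ->
  \oo `<=` V -> (forall n, V (P n)) ->
  exists i_ : nat -> nat, i_ @ \oo --> \oo /\ forall n, P n (i_ n).
Proof.
move=> VU ooV VP; have /choice[i_ hi] : forall n, exists i, (n <= i)%N /\ P n i.
  move=> n; have [i [ni Pi]] : exists i, ([set i | (n <= i)%N] `&` P n) i.
    by apply: (@filter_ex _ V); apply: filterI => //; apply: ooV; exists n.
  by exists i.
exists i_; split=> [B [N _ NB]|n]; last by have [] := hi n.
exists N => // n /= Nn; apply: NB; apply: (leq_trans Nn); by have [] := hi n.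
Qed.

Lemma free_ultrafilter : exists2 V : set_system nat, UltraFilter V & \oo `<=` V.
Proof.
by have [V [VU ooV]] := ultraFilterLemma (@eventually_filter); exists V.
Qed.

Lemma weak_lim_extract s : ultra_weakly_cvg (range s) ->
  exists (i_ : nat -> nat) x, i_ @ \oo --> \oo /\ weak_lim \oo (s \o i_) x.
Proof.
move=> su; have [V VU ooV] := free_ultrafilter.
have [|x sx] := ultra_weakly_cvg_fam su VU (s := s).
  by apply: filterE => n; exists n.
have [P [VP Px]] := weak_lim_ultra_extract VU su sx.
have [i_ [ioo iP]] := ultra_choice VU ooV VP.
by exists i_, x; split => //; exact: Px.
Qed.

End Subsequences.

(* [compact_cover] requires a pointed space. *)
HB.instance Definition _ (R : realType) (E : normedModType R) :=
  isPointed.Build (weak E) (0 : E).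

Section Kakutani.
Context {R : realType} {E : normedModType R}.
Implicit Types (f : dual E) (K : set E) (x y z : E) (d : nat -> E).

Lemma cvg_sum_seq (T I : Type) (F : set_system T) {FF : Filter F} (r : seq I)
   (g : I -> T -> R) (l : I -> R) : (forall i, g i @ F --> l i) ->
  (fun t => \sum_(i <- r) g i t) @ F --> \sum_(i <- r) l i.
Proof.
move=> h; elim: r => [|i r IH].
  by under eq_fun do rewrite big_nil; rewrite big_nil; exact: cvg_cst.
by under eq_fun do rewrite big_cons; rewrite big_cons; apply: cvgD.
Qed.

(* Were there no fixed point, separating [x] from [F x] and gluing the separating
   functionals by a partition of unity would give [psi] with [psi x y > 0] for all
   [y] in [F x], against the KKM lemma applied to [fun x => psi x y <= 0]. *)
Lemma kakutani_weak K (F : E -> set E) d : ultra_weakly_cvg K -> closed K ->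
  convex_set (K : set (convex_lmodType E)) ->
  range d `<=` K -> K `<=` closure (range d) ->
  (forall x, K x -> closed (F x) /\ convex_set (F x : set (convex_lmodType E))) ->
  (forall x, K x -> exists2 y, K y & F x y) ->
  (forall (x_ y_ : nat -> E) x y, (forall n, K (x_ n)) -> (forall n, K (y_ n)) ->
     K x -> weak_lim \oo x_ x -> (forall n, F (x_ n) (y_ n)) -> weak_lim \oo y_ y -> F x y) ->
  exists2 x, K x & F x x.
Proof.
move=> Ku Kcl Kcv dK Kd Fcc FK Fg.
have Kco : weakly_compact K by exact: closed_convex_weakly_compact.
have Klim (s : nat -> E) x : (forall n, K (s n)) -> weak_lim \oo s x -> K x.
  by move=> Ks; apply: weak_lim_closed_convex => //; exact: filterE.
have Kus (s : nat -> E) : (forall n, K (s n)) -> ultra_weakly_cvg (range s).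
  by move=> Ks; apply: ultra_weakly_cvgW Ku => _ [n _ <-].
have [h hd] := separable_separates d.
have hK : separates h K by move=> x y /Kd Kx /Kd Ky; exact: hd.
apply: contrapT => nofix.
pose pp (a : R) := a + `|a|.
have pp_le0 a : a <= 0 -> pp a = 0.
  by move=> a0; rewrite /pp ler0_norm// subrr.
have pp_gt0 a : 0 < a -> 0 < pp a.
  by move=> a0; rewrite /pp gtr0_norm// addr_gt0.
have pp_cvg (T : Type) (G : set_system T) (g : T -> R) l : Filter G -> g @ G --> l ->
    (fun t => pp (g t)) @ G --> pp l.
  by move=> GF gl; apply: cvgD => //; exact: cvg_norm.
(* A weakly continuous bump around [x], positive exactly where the first [m] functionals differ from
   their values at [x] by less than [1 / m.+1]; [pp] is twice the positive part. *)
pose phi m x z := \prod_(j <- iota 0 m) pp (m.+1%:R^-1 - `|h j x - h j z|).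
have phi_ge0 m x z : 0 <= phi m x z.
  apply: prodr_ge0 => j _; rewrite /pp; set a := _ - _.
  have := ler_norm (- a); rewrite normrN; lra.
have phi_gt0 m x z : 0 < phi m x z -> forall j, (j < m)%N -> `|h j x - h j z| <= m.+1%:R^-1.
  rewrite lt0r => /andP[+ _] j jm; rewrite /phi prodf_seq_neq0 => /allP /(_ j).
  rewrite mem_iota add0n => /(_ jm) /=; apply: contraNT; rewrite -ltNge => lt.
  by rewrite pp_le0// subr_le0 ltW.
have phixx m x : 0 < phi m x x.
  apply: prodr_gt0 => j _; rewrite subrr normr0 subr0.
  by apply: pp_gt0; rewrite invr_gt0.
have phi_cvg m x (T : Type) (G : set_system T) (s : T -> E) z : Filter G -> weak_lim G s z ->
    (fun t => phi m x (s t)) @ G --> phi m x z.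
  move=> GF sz; rewrite /phi; elim: (iota 0 m) => [|j r IH].
    by under eq_fun do rewrite big_nil; rewrite big_nil; exact: cvg_cst.
  under eq_fun do rewrite big_cons; rewrite big_cons; apply: cvgM => //.
  apply: pp_cvg; apply: cvgB; first exact: cvg_cst.
  by apply: cvg_norm; apply: cvgB; [exact: cvg_cst|exact: sz].
(* A functional separating [x] from [F x] within [K], with an [m] such that it still separates
   wherever the bump is positive. Failure for all [m] would give points tending to [x] and, in the
   limit, a point of [F x] violating the separation. *)
have /choice[fm hfm] : forall x, exists fm : dual E * nat, K x ->
    forall z, K z -> 0 < phi fm.2 x z -> forall y, K y -> F z y -> fm.1 y < fm.1 z.
  move=> x; have [Kx|nK] := pselect (K x); last first.
    by have [f _ _] := norming_functional x; exists (f, 0%N).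
  have [Fcl Fcv] := Fcc x Kx.
  have nFx : ~ (F x `&` K) x by move=> [Fxx _]; apply: nofix; exists x.
  have FKcv : convex_set (F x `&` K : set (convex_lmodType E)).
    move/convex_setP: Fcv => Fcv; move/convex_setP: Kcv => Kcv'; apply/convex_setP.
    by move=> u v t [Fu Ku'] [Fv Kv] t01; split; [exact: Fcv|exact: Kcv'].
  have [f [e e0 fe]] := closed_convex_separation (closedI Fcl Kcl) FKcv nFx.
  apply: contrapT => /forallNP H.
  have /choice[zy hzy] : forall m, exists zy : E * E, [/\ K zy.1, 0 < phi m x zy.1, K zy.2,
      F zy.1 zy.2 & f zy.1 <= f zy.2].
    move=> m; have /not_implyP[_ /existsNP[z /not_implyP[Kz /not_implyP[pz]]]] := H (f, m).
    move=> /existsNP[y /not_implyP[Ky /not_implyP[Fzy /negP]]].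
    by rewrite -leNgt => ?; exists (z, y).
  have zx : weak_lim \oo (fun m => (zy m).1) x.
    apply: (@weak_lim_separates _ _ _ h K) => //.
      move=> V VU _; have [|u Vu] := ultra_weakly_cvg_fam Ku VU (s := fun m => (zy m).1).
        by apply: filterE => m; have [] := hzy m.
      exists u => //; apply: (weak_lim_closed_convex Kcl Kcv _ Vu).
      by apply: filterE => m; have [] := hzy m.
    move=> j; apply/cvgrPdist_le => c c0.
    near=> n; apply: (@le_trans _ _ n.+1%:R^-1).
      have [_ /phi_gt0 pz _ _ _] := hzy n; apply: pz.
      by near: n; exists j.+1.
    near: n; exact: near_harmonic.
  have [i_ [y [ioo yy]]] : exists (i_ : nat -> nat) y, i_ @ \oo --> \oo /\
      weak_lim \oo ((fun m => (zy m).2) \o i_) y.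
    by apply: weak_lim_extract; apply: Kus => m; have [] := hzy m.
  have zix := weak_lim_subseq zx ioo.
  have Ky : K y by apply: Klim yy => m /=; have [] := hzy (i_ m).
  have Fxy : F x y.
    by apply: Fg zix _ yy => // m /=; have [] := hzy (i_ m).
  have /fe : (F x `&` K) y by [].
  have : f x <= f y.
    by apply: (ler_cvg_to (zix f) (yy f)); apply: filterE => m /=; have [] := hzy (i_ m).
  by move=> h1 h2; have := le_trans h2 h1; rewrite gerDl leNgt e0.
have [xs xsK xs_cover] : exists2 xs : seq E, (forall x, x \in xs -> K x) &
    forall z, K z -> exists2 x, x \in xs & 0 < phi (fm x).2 x z.
  have := Kco; rewrite /weakly_compact (@compact_cover (weak E)).
  move=> /(_ E K (fun x => [set z | 0 < phi (fm x).2 x z] : set (weak E))) [].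
  - move=> x Kx; rewrite openE => z /= z0.
    have : (fun t : weak E => phi (fm x).2 x t) @ nbhs (z : weak E) --> phi (fm x).2 x z.
      apply: (phi_cvg _ _ _ _ id); exact/weak_cvgE.
    by move=> /cvgr_gt/(_ _ z0).
  - by move=> z Kz; exists z => //=.
  - move=> D DK Dc; exists (finmap.enum_fset D).
      by move=> x /DK; rewrite inE.
    by move=> z /Dc[x xD xz]; exists x.
pose psi x y := \sum_(z <- xs) phi (fm z).2 z x * ((fm z).1 x - (fm z).1 y).
have psi_gt0 x y : K x -> K y -> F x y -> 0 < psi x y.
  move=> Kx Ky Fxy; rewrite /psi big_seq lt0r.
  have t0 z : z \in xs -> 0 <= phi (fm z).2 z x * ((fm z).1 x - (fm z).1 y).
    move=> zxs; have [->|nz] := eqVneq (phi (fm z).2 z x) 0; first by rewrite mul0r.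
    rewrite mulr_ge0// subr_ge0 ltW//; apply: hfm => //; first exact: xsK.
    by rewrite lt0r nz phi_ge0.
  rewrite sumr_ge0// andbT psumr_neq0//.
  have [z zxs z0] := xs_cover x Kx; apply/hasP; exists z => //; rewrite zxs /=.
  by rewrite mulr_gt0// subr_gt0; apply: (hfm z) => //; exact: xsK.
have psi_approx n : exists x_ : nat -> E, forall j, (j < n.+1)%N ->
    [/\ K (x_ j), psi (x_ j) (d j) <= 0 & `|x_ j - x_ 0%N| <= n.+1%:R^-1].
  apply: (@kkm_approx _ _ n d K (fun j x => psi x (d j) <= 0)).
  - by rewrite invr_gt0.
  - by move/convex_setP: Kcv => Kcv' x y a Kx Ky a01; exact: Kcv'.
  - by move=> i _; apply: dK; exists i.
  move=> p p0 p1; set x := \sum_(i < _) _; apply: contrapT => /forallNP nH.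
  (* In its second argument [psi x] is affine and vanishes at [x], so it cannot be positive at every
     [d i] with [p i > 0]. *)
  have psum : \sum_(i < n.+1) p i * psi x (d i) = 0.
    rewrite /psi; under eq_bigr do rewrite mulr_sumr; rewrite exchange_big /=.
    rewrite big1// => z _.
    under eq_bigr do rewrite mulrCA; rewrite -mulr_sumr.
    under eq_bigr do rewrite mulrBr; rewrite sumrB -mulr_suml p1 mul1r.
    rewrite [X in _ - X](_ : _ = (fm z).1 x) ?subrr ?mulr0//.
    rewrite /x /dual_fun linear_sum; apply: eq_bigr => i _.
    by rewrite linearZ.
  have pos i : (i < n.+1)%N -> 0 < p i -> 0 < psi x (d i).
    by move=> i_n pi; rewrite ltNge; apply/negP => le0; apply: (nH i).
  have t0 (i : 'I_n.+1) : true -> 0 <= p i * psi x (d i).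
    move=> _; have [->|nz] := eqVneq (p i) 0; first by rewrite mul0r.
    have pi : 0 < p i by rewrite lt0r nz p0.
    by rewrite mulr_ge0// ltW// pos.
  move/eqP: psum; rewrite psumr_eq0// => /allP H.
  have : \sum_(i < n.+1) p i = 0.
    apply: big1 => i _; apply/eqP; apply: contraT => nz.
    have pi : 0 < p i by rewrite lt0r nz p0.
    have := H i (mem_index_enum _); rewrite /= mulf_eq0 (negbTE nz) /=.
    by rewrite gt_eqF// pos.
  by rewrite p1 => /eqP; rewrite oner_eq0.
have /choice[X hX] := psi_approx.
have KX0 n : K (X n 0%N) by have [] := hX n 0%N isT.
have [i_ [x [ioo Xx]]] := weak_lim_extract (Kus (fun n => X n 0%N) KX0).
have Kx : K x by apply: Klim Xx => n; exact: KX0.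
(* The clusters of points shrink, so every index [j] has the same weak limit. *)
have Xjx j : weak_lim \oo (fun n => X (i_ n) j) x.
  apply: weak_lim_approx => e e0; exists (fun n => X (i_ n) 0%N), x; split=> //.
    by rewrite subrr normr0 ltW.
  have H : \forall n \near \oo, (j < n.+1)%N /\ n.+1%:R^-1 <= e.
    near=> n; split; first by near: n; exists j.
    near: n; exact: near_harmonic.
  have Hi : \forall n \near \oo, (j < (i_ n).+1)%N /\ (i_ n).+1%:R^-1 <= e := ioo _ H.
  apply: filterS Hi => n [jn ne] /=; apply: le_trans ne.
  by have [] := hX (i_ n) j jn.
have psid j : psi x (d j) <= 0.
  have cv : (fun n => psi (X (i_ n) j) (d j)) @ \oo --> psi x (d j).
    apply: cvg_sum_seq => z; apply: cvgM; first exact: phi_cvg.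
    by apply: cvgB; [exact: Xjx|exact: cvg_cst].
  apply: (cvgr_to_le cv).
  have H : \forall n \near \oo, (j < n.+1)%N by exists j.
  have Hi : \forall n \near \oo, (j < (i_ n).+1)%N := ioo _ H.
  by apply: filterS Hi => n jn; have [] := hX (i_ n) j jn.
have [y Ky Fxy] := FK x Kx; have := psi_gt0 _ _ Kx Ky Fxy.
apply/negP; rewrite -leNgt.
have /choice[j hj] : forall n : nat, exists j, `|y - d j| <= n.+1%:R^-1.
  move=> n; have /closure_normP/(_ n.+1%:R^-1) := Kd _ Ky.
  by rewrite invr_gt0 ltr0n => /(_ isT)[_ [j _ <-]]; exists j.
have dy : weak_lim \oo (d \o j) y.
  apply: cvg_weak_lim; apply/cvgrPdist_le => e e0.
  apply: filterS (near_harmonic e0) => n.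
  exact: le_trans (hj n).
have cv : (fun n => psi x (d (j n))) @ \oo --> psi x y.
  apply: cvg_sum_seq => z; apply: cvgM; first exact: cvg_cst.
  by apply: cvgB; [exact: cvg_cst|exact: dy].
by apply: (cvgr_to_le cv); exact: filterE.
Unshelve. all: by end_near. Qed.

End Kakutani.

(** * De Blasi measure and condensing maps *)

Section DeBlasiTheory.
Context {R : realType} {E : completeNormedModType R}.
Implicit Types (A K M W : set E) (x y z : E).

Lemma bounded_setE W : bounded_set W <-> exists M : R, forall x, W x -> `|x| <= M.
Proof.
split=> [[M [Mr WM]]|[M WM]]; first by exists (M + 1); apply: WM; rewrite ltrDl.
by exists M; split=> [|r Mr x /WM /le_trans]; [rewrite num_real|apply; exact: ltW].
Qed.

Definition weakly_compact_approx W (e : R) := 0 < e /\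
  exists2 K, weakly_compact K & forall x, W x -> exists2 k, K k & `|x - k| <= e.

Lemma de_blasiE W : de_blasi W = inf (weakly_compact_approx W).
Proof.
congr inf; apply/seteqP; split=> [e [e0 [K [Kc WK]]]|e [e0 [K Kc WK]]].
  split=> //; exists K => // x /WK[k Kk [b]].
  rewrite closed_ballE// /closed_ball_ /= sub0r normrN => be <-; exists k => //.
  by rewrite addrAC subrr add0r.
split=> //; exists K; split=> // x /WK[k Kk xk]; exists k => //; exists (x - k).
  by rewrite closed_ballE// /closed_ball_ /= sub0r normrN.
by rewrite addrC subrK.
Qed.

Lemma de_blasi_lb W : has_lbound (weakly_compact_approx W).
Proof. by exists 0 => e [/ltW]. Qed.

Lemma de_blasi_le W e : weakly_compact_approx W e -> de_blasi W <= e.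
Proof. by rewrite de_blasiE; apply: ge_inf; exact: de_blasi_lb. Qed.

Lemma weakly_compact_set1 x : weakly_compact [set x].
Proof. exact: (@compact_set1 (weak E)). Qed.

Lemma de_blasi_has_inf W : bounded_set W -> has_inf (weakly_compact_approx W).
Proof.
move=> /bounded_setE[M WM]; split; last exact: de_blasi_lb.
exists (`|M| + 1); split; first by rewrite ltr_wpDl.
exists [set 0]; first exact: weakly_compact_set1.
move=> x /WM xM; exists 0 => //; rewrite subr0 (le_trans xM)// ler_wpDr//.
exact: ler_norm.
Qed.

Lemma le_de_blasi W (c : R) : bounded_set W ->
  (forall e, weakly_compact_approx W e -> c <= e) -> c <= de_blasi W.
Proof. by move=> Wb h; rewrite de_blasiE; apply: lb_le_inf => //; case: (de_blasi_has_inf Wb). Qed.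

Lemma de_blasi_ge0 W : bounded_set W -> 0 <= de_blasi W.
Proof. by move=> Wb; apply: le_de_blasi => // e [/ltW]. Qed.

Lemma weakly_compact_approx_gt W e : bounded_set W -> de_blasi W < e ->
  weakly_compact_approx W e.
Proof.
move=> Wb; rewrite de_blasiE => We.
have /inf_adherent/(_ (de_blasi_has_inf Wb))[d [d0 [K Kc WK]]] :
  0 < e - inf (weakly_compact_approx W) by rewrite subr_gt0.
rewrite addrC subrK => de; split; first exact: lt_trans de.
exists K => // x /WK[k Kk xk]; exists k => //; exact: le_trans (ltW de).
Qed.

Lemma de_blasi_ultra W : bounded_set W -> de_blasi W <= 0 -> ultra_weakly_cvg (closure W).
Proof.
move=> Wb W0; apply: ultra_weakly_cvg_approx => e e0.
have e20 : 0 < e / 2 by rewrite divr_gt0.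
have [_ [K Kc WK]] := weakly_compact_approx_gt Wb (le_lt_trans W0 e20).
exists K; first exact: weakly_compact_ultra.
move=> x /closure_normP/(_ _ e20)[a /WK[k Kk ak] xa]; exists k => //.
by rewrite -(subrKA a) (le_trans (ler_normD _ _))// [leRHS]splitr lerD.
Qed.

(** The measure asks for an actual weakly compact set around the range; Krein's theorem supplies
    it. *)
Lemma de_blasi_range_ultra (s : nat -> E) : bounded_set (range s) ->
  ultra_weakly_cvg (range s) -> de_blasi (range s) = 0.
Proof.
move=> sb su; apply/eqP; rewrite eq_le de_blasi_ge0// andbT.
have /bounded_setE[M sM] := sb.
have [|K [Kc _ sK]] := weakly_compact_convex_superset _ su (M := M).
  by move=> i; apply: sM; exists i.
apply/ler_addgt0Pr => e e0; rewrite add0r; apply: de_blasi_le; split=> //.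
exists K => // x /sK Kx; exists x => //; by rewrite subrr normr0 ltW.
Qed.

Lemma condensing_fixed_point (S : set E) (F : E -> set E) (f : E -> E) :
  S !=set0 -> closed S -> convex_set (S : set (convex_lmodType E)) ->
  (forall x, S x -> closed (F x) /\ convex_set (F x : set (convex_lmodType E))) ->
  (forall x, S x -> S (f x) /\ F x (f x)) ->
  bounded_set (f @` S) ->
  (forall d : nat -> E, range d `<=` S -> bounded_set (range d) ->
     0 < de_blasi (range d) -> de_blasi (range (f \o d)) < de_blasi (range d)) ->
  (forall (x_ y_ : nat -> E) x y, (forall n, S (x_ n)) -> bounded_set (range x_) ->
     bounded_set (range y_) -> S x -> weak_lim \oo x_ x -> (forall n, F (x_ n) (y_ n)) ->
     weak_lim \oo y_ y -> F x y) ->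
  exists2 x, S x & F x x.
Proof.
move=> [x0 Sx0] Scl Scv Fcc Sf /bounded_setE[M fM] fcond Fg.
have [d [x0d fd dcv dmin]] := dense_hull (fun=> x0) f.
have SQ : convex_pred S by move/convex_setP: Scv => Sc x y a Sx Sy a01; exact: Sc.
have dS : range d `<=` S.
  by apply: dmin => // [_ [_ _ <-]//|x _ /Sf[]].
pose M' := Num.max M `|x0|.
have dM : range d `<=` [set x | `|x| <= M'].
  apply: dmin => [x y a xM yM /andP[a0 a1]|_ [_ _ <-]|x xd _] /=.
  - rewrite /= (le_trans (ler_normD _ _))// !normrZ (ger0_norm a0) ger0_norm ?subr_ge0//.
    have -> : M' = a * M' + (1 - a) * M' by ring.
    by rewrite lerD// ler_wpM2l// subr_ge0.
  - by rewrite le_max lexx orbT.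
  - by rewrite le_max fM//; exists x => //; exact: dS.
have db : bounded_set (range d) by apply/bounded_setE; exists M'.
have fdb : bounded_set (range (f \o d)).
  apply/bounded_setE; exists M => _ [i _ <-]; apply: fM; exists (d i) => //.
  by apply: dS; exists i.
(* The hull lies in every convex set containing [x0] and the [f (d i)]; here this is the
   [e]-neighbourhood of a convex weakly compact set obtained from Krein's theorem. *)
have dfd : de_blasi (range d) <= de_blasi (range (f \o d)).
  apply: le_de_blasi => // e [e0 [K Kc fdK]]; apply: de_blasi_le; split=> //.
  have /choice[k hk] : forall i, exists k, K k /\ `|f (d i) - k| <= e.
    by move=> i; have [|k Kk fk] := fdK (f (d i)); [exists i|exists k].
  (* Index 0 is spent on [x0], the seed of the hull. *)
  pose k' i := if i is i'.+1 then k i' else x0.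
  have k'u : ultra_weakly_cvg (range k').
    apply: (@ultra_weakly_cvgW _ _ _ (K `|` [set x0])).
      by move=> _ [[|i] _ <-] /=; [right|left; case: (hk i)].
    apply: weakly_compact_ultra; apply: (@compactU (weak E)) => //.
    exact: weakly_compact_set1.
  have [|K' [K'c K'cv k'K]] := weakly_compact_convex_superset _ k'u (M := M' + e).
    case=> [|i] /=; first by rewrite ler_wpDr ?(ltW e0)// le_max lexx orbT.
    have [_ fk] := hk i; rewrite -[k i](subrK (f (d i))) addrC (le_trans (ler_normD _ _))// lerD//.
      by apply: dM; apply: fd; exists i.
    by rewrite distrC.
  exists K' => //; apply: dmin => [x y a [u Ku xu] [v Kv yv] /andP[a0 a1]|_ [_ _ <-]|_ [i _ <-] _].
  - exists (a *: u + (1 - a) *: v).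
      by move/convex_setP: K'cv; apply => //; rewrite a0 a1.
    rewrite convex_combinationB (le_trans (ler_normD _ _))// !normrZ (ger0_norm a0).
    rewrite ger0_norm ?subr_ge0//.
    have -> : e = a * e + (1 - a) * e by ring.
    by rewrite lerD// ler_wpM2l// subr_ge0.
  - by exists x0; [apply: k'K; exists 0%N|rewrite subrr normr0 ltW].
  - by exists (k i); [apply: k'K; exists i.+1|case: (hk i)].
have d0 : de_blasi (range d) <= 0.
  by rewrite leNgt; apply/negP => /(fcond d dS db); rewrite ltNge dfd.
have Ku := de_blasi_ultra db d0; set K := closure (range d) in Ku dcv.
have dK : range d `<=` K by exact: subset_closure.
have KS : K `<=` S by move/closure_id: Scl => ->; exact: closure_subset.
have KM x : K x -> `|x| <= M'.
  move=> /closure_normP Kx; apply/ler_addgt0Pr => e e0.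
  have [a /dM /= aM xa] := Kx e e0.
  by rewrite -[x](subrK a) addrC (le_trans (ler_normD _ _))// lerD.
have Kb (s : nat -> E) : (forall n, K (s n)) -> bounded_set (range s).
  by move=> Ks; apply/bounded_setE; exists M' => _ [n _ <-]; exact: KM.
have [|||x Kx Fxx] := kakutani_weak (F := F) Ku (@closed_closure _ (range d)) dcv dK (fun _ => id).
- by move=> x /KS/Fcc.
(* For [d (j n)] tending to [x], the values [f (d (j n))] remain in [K]; a weak limit of a
   subsequence of them lies in [F x] by the graph hypothesis. *)
- move=> x Kx; have /choice[j hj] : forall n : nat, exists j, `|x - d j| <= n.+1%:R^-1.
    move=> n; have /closure_normP/(_ n.+1%:R^-1) := Kx.
    by rewrite invr_gt0 ltr0n => /(_ isT)[_ [j _ <-]]; exists j.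
  have dx : weak_lim \oo (d \o j) x.
    apply: cvg_weak_lim; apply/cvgrPdist_le => e e0.
    apply: filterS (near_harmonic e0) => n.
    exact: le_trans (hj n).
  have fK n : K (f (d (j n))) by apply: dK; apply: fd; exists (j n).
  have [|i_ [y [ioo fy]]] := weak_lim_extract (s := fun n => f (d (j n))).
    by apply: ultra_weakly_cvgW Ku => _ [n _ <-].
  exists y.
    apply: (weak_lim_closed_convex (@closed_closure _ (range d)) dcv _ fy).
    by apply: filterE => n; exact: fK.
  apply: (Fg _ _ _ _ _ _ _ _ (weak_lim_subseq dx ioo) _ fy) => [n||||n].
  + by apply: dS; exists (j (i_ n)).
  + by apply: Kb => n; apply: dK; exists (j (i_ n)).
  + by apply: Kb => n; exact: fK.
  + exact: KS.
  + by have [|_ Ff] := Sf (d (j (i_ n))) => //; apply: dS; exists (j (i_ n)).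
- move=> x_ y_ x y Kx_ Ky_ Kx xx Fxy yy; apply: (Fg x_ y_) => //.
  + by move=> n; exact: KS.
  + exact: Kb.
  + exact: Kb.
  + exact: KS.
by exists x => //; exact: KS.
Qed.

End DeBlasiTheory.

(** * Products and weak limits *)

Section Products.
Context {R : realType} {E : banachAlgType R}.
Implicit Types (x y : E) (a b : nat -> E).

Lemma bmulBr x y z : bmul x (y - z) = bmul x y - bmul x z :> E.
Proof. by rewrite bmulDr -scaleN1r bmulZr scaleN1r. Qed.

Lemma weak_lim_bmulr (T : Type) (F : set_system T) {FF : Filter F} (s : T -> E) x y :
  weak_lim F s x -> weak_lim F (fun t => bmul (s t) y) (bmul x y).
Proof.
move=> sx f; have [C C0 fC] := dual_bound f.
have gl : linear ((fun z => f (bmul z y)) : E -> R^o).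
  by move=> t u v; rewrite bmulDl bmulZl dualD dualZ.
pose gm := GRing.isLinear.Build _ _ _ _ _ gl.
pose g : {linear E -> R^o} := HB.pack (fun z => f (bmul z y)) gm.
have [z|h hE] := @bounded_dual R E g (C * `|y|).
  by apply: (le_trans (fC _)); rewrite -mulrA ler_pM2l// mulrC normr_bmul.
have := sx h; rewrite hE; under eq_fun do rewrite hE; exact.
Qed.

(** Let [c] be the limit of [f] on the products along [V]. Indices chosen in the sets extracted for
    [a] and for [b], and where the product is close to [c], form a sequence to which (P) applies, so
    [c] is [f (bmul x y)]. *)
Lemma ultra_weakly_cvg_bmul a b (M : R) : condition_P E ->
  (forall n, `|bmul (a n) (b n)| <= M) ->
  ultra_weakly_cvg (range a) -> ultra_weakly_cvg (range b) ->
  forall (V : set_system nat) x y, UltraFilter V -> weak_lim V a x -> weak_lim V b y ->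
    weak_lim V (fun n => bmul (a n) (b n)) (bmul x y).
Proof.
move=> EP abM au bu V x y VU ax bx f; have [C C0 fC] := dual_bound f.
have [n|c abc] := @ultra_bounded_cvg _ _ V (fun n => f (bmul (a n) (b n))) (C * M) VU.
  by apply: (le_trans (fC _)); rewrite ler_pM2l.
suff -> : f (bmul x y) = c by [].
have [P [VP Px]] := weak_lim_ultra_extract VU au ax.
have [Q [VQ Qy]] := weak_lim_ultra_extract VU bu bx.
have en n : 0 < n.+1%:R^-1 :> R by rewrite invr_gt0.
have /choice[i_ hi] : forall n, exists i, [/\ P n i, Q n i &
    `|c - f (bmul (a i) (b i))| <= n.+1%:R^-1].
  move=> n; have /cvgrPdist_le/(_ _ (en n)) Vc := abc.
  have [i [[Pi Qi] ci]] : exists i, ((P n `&` Q n) `&`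
      [set i | `|c - f (bmul (a i) (b i))| <= n.+1%:R^-1]) i.
    by apply: (@filter_ex _ V); apply: filterI => //; exact: filterI.
  by exists i.
have ai : weak_lim \oo (a \o i_) x by apply: Px => n; case: (hi n).
have bi : weak_lim \oo (b \o i_) y by apply: Qy => n; case: (hi n).
have /weak_cvgP/(_ f) h1 := EP _ _ _ _ (iffRL (weak_cvgP _ _) ai) (iffRL (weak_cvgP _ _) bi).
have h2 : (fun n => f (bmul (a (i_ n)) (b (i_ n)))) @ \oo --> c.
  apply/cvgrPdist_le => e e0.
  apply: filterS (near_harmonic e0) => n.
  by have [_ _] := hi n; exact: le_trans.
exact: (cvg_unique _ h1 h2).
Qed.

End Products.

(** * The quotient map *)

Lemma ultra_nat (V : set_system nat) : UltraFilter V ->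
  \oo `<=` V \/ exists n, V [set n].
Proof.
move=> VU; have [[n Vn]|nV] := pselect (exists n, V [set n]); [by right; exists n|left].
have fin N : V [set n | (N <= n)%N].
  elim: N => [|N IH]; first by apply: filterE.
  have [VN|VN] := in_ultra_setVsetC [set N] VU; first by case: nV; exists N.
  apply: filterS2 IH VN => n /= Nn nN; rewrite ltn_neqAle Nn andbT.
  by apply/eqP => h; apply: nN.
by move=> A [N _ NA]; apply: filterS (fin N) => n; exact: NA.
Qed.

Section FixedPoint.
Context {R : realType} {E : banachAlgType R}.
Implicit Types (a b c x y z : E) (A B C : E -> set E).

(** A free ultrafilter inherits the limit [x]; a principal one picks out a single term. *)
Lemma weak_lim_range_ultra (s : nat -> E) x : weak_lim \oo s x -> ultra_weakly_cvg (range s).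
Proof.
move=> sx; apply: ultra_weakly_cvg_range => V VU.
have [ooV|[n Vn]] := ultra_nat VU; first by exists x; exact: weak_lim_sub sx.
exists (s n) => f; apply: cvg_near_cst.
by apply: filterS Vn => _ ->.
Qed.

Lemma weakly_compact_approx_range (g m : nat -> E) (M e : R) : 0 < e ->
  (forall i, `|g i - m i| <= e) -> (forall i, `|m i| <= M) ->
  ultra_weakly_cvg (range m) -> weakly_compact_approx (range g) e.
Proof.
move=> e0 gm mM mu; split=> //.
have [K [Kc _ mK]] := weakly_compact_convex_superset mM mu.
by exists K => // _ [i _ <-]; exists (m i) => //; apply: mK; exists i.
Qed.

Lemma weakly_compact_approx_choice (W : set E) (e : R) (s : nat -> E) (M : R) :
  weakly_compact_approx W e -> (forall i, W (s i)) -> (forall i, `|s i| <= M) ->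
  exists k : nat -> E, [/\ ultra_weakly_cvg (range k), forall i, `|s i - k i| <= e
    & forall i, `|k i| <= M + e].
Proof.
move=> [e0 [K Kc WK]] Ws sM.
have /choice[k hk] : forall i, exists k, K k /\ `|s i - k| <= e.
  by move=> i; have [k Kk sk] := WK _ (Ws i); exists k.
exists k; split=> [|i|i]; last 2 first.
- by have [] := hk i.
- rewrite -[k i](subrK (s i)) addrC (le_trans (ler_normD _ _))// lerD// distrC.
  by have [] := hk i.
apply: ultra_weakly_cvgW (weakly_compact_ultra Kc) => _ [i _ <-].
by have [] := hk i.
Qed.

Lemma bounded_setW (W W' : set E) : W `<=` W' -> bounded_set W' -> bounded_set W.
Proof.
by move=> WW /bounded_setE[M WM]; apply/bounded_setE; exists M => x /WW; exact: WM.
Qed.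

Lemma mimageS A (W W' : set E) : W `<=` W' -> mimage A W `<=` mimage A W'.
Proof. by move=> WW y [x Wx Axy]; exists x => //; exact: WW. Qed.

Lemma countable_range (d : nat -> E) : countable (range d).
Proof. exact: (card_image_le d [set: nat]). Qed.

Section Hypotheses.
Variables (A C : E -> set E).
Hypotheses (A_cv : closed_convex_valued setT A) (C_cv : closed_convex_valued setT C).
Hypothesis A_graph : weakly_seq_closed_graph setT A.
Hypothesis C_graph : weakly_seq_closed_graph setT C.
Hypothesis A_wcompact : weakly_compact_map setT A.
Hypothesis A_bounded : bounded_set (mimage A setT).
Hypothesis C_bounded : bounded_set (mimage C setT).

Let A_ultra (s a : nat -> E) : bounded_set (range s) -> (forall n, A (s n) (a n)) ->
  ultra_weakly_cvg (range a).
Proof.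
move=> sb As; have := relatively_weakly_compact_ultra (A_wcompact (fun _ _ => I) sb).
by apply: ultra_weakly_cvgW => _ [n _ <-]; exists (s n) => //; exists n.
Qed.

(** For fixed [y], [condensing_fixed_point] applies on the whole space; this makes the values of [N]
    nonempty. *)
Lemma solution_exists (Psi : R -> R) y : D_set_contraction setT C Psi ->
  exists x a c, [/\ A x a, C x c & bmul a y + c = x].
Proof.
move=> [[_ _ _ _ Psi_lt] C_contr].
have /bounded_setE[MA AM] := A_bounded; have /bounded_setE[MC CM] := C_bounded.
have AM' x a : A x a -> `|a| <= MA by move=> Aa; apply: AM; exists x.
have CM' x c : C x c -> `|c| <= MC by move=> Cc; apply: CM; exists x.
pose F x := [set z | exists a c, [/\ A x a, C x c & bmul a y + c = z]].
suff [x _ [a [c [Aa Cc xE]]]] : exists2 x, [set: E] x & F x x by exists x, a, c.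
have /choice[g hg] : forall x, exists ac : E * E, A x ac.1 /\ C x ac.2.
  move=> x; have [[a Aa] _ _] := A_cv (x := x) I; have [[c Cc] _ _] := C_cv (x := x) I.
  by exists (a, c).
pose f x := bmul (g x).1 y + (g x).2.
have gM x : `|bmul (g x).1 y| <= MA * `|y|.
  by apply: (le_trans (normr_bmul _ _)); rewrite ler_wpM2r// (AM' x)//; case: (hg x).
have Au x a (s : nat -> E) : (forall n, A x (s n)) -> ultra_weakly_cvg (range s).
  move=> As; apply: (A_ultra (s := fun=> x)) => //.
  by apply/bounded_setE; exists `|x| => _ [_ _ <-].
apply: (condensing_fixed_point (f := f)).
- by exists 0.
- exact: closedT.
- by apply/convex_setP.
- move=> x _; have [_ Acl Acv] := A_cv (x := x) I; have [_ Ccl Ccv] := C_cv (x := x) I.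
  split.
    move=> z /closure_normP Fz.
    have /choice[ac hac] : forall n : nat, exists ac : E * E, [/\ A x ac.1, C x ac.2 &
        `|z - (bmul ac.1 y + ac.2)| <= n.+1%:R^-1].
      move=> n; have := Fz n.+1%:R^-1; rewrite invr_gt0 ltr0n => /(_ isT).
      by move=> [_ [a [c [Aa Cc <-]]] ?]; exists (a, c).
    have [V VU ooV] := free_ultrafilter.
    have [||a aV] :=
      ultra_weakly_cvg_fam (Au x 0 (fun n => (ac n).1) _) VU (s := fun n => (ac n).1).
      by move=> n; case: (hac n).
      by apply: filterE => n; exists n.
    have zV : weak_lim V (fun n => bmul (ac n).1 y + (ac n).2) z.
      apply: (weak_lim_sub ooV); apply: cvg_weak_lim; apply/cvgrPdist_le => e e0.
      apply: filterS (near_harmonic e0) => n.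
      by have [_ _] := hac n; exact: le_trans.
    (* Compactness is available for the [A]-parts only; the limit of the [C]-parts is found by
       subtraction. *)
    exists a, (z - bmul a y); split; last by rewrite addrC subrK.
      by apply: (weak_lim_closed_convex Acl Acv _ aV); apply: filterE => n; case: (hac n).
    have cV := weak_limB zV (weak_lim_bmulr (y := y) aV).
    apply: (weak_lim_closed_convex Ccl Ccv _ (cV _ _)).
    by apply: filterE => n /=; rewrite addrAC subrr add0r; case: (hac n).
  move/convex_setP: Acv => Acv; move/convex_setP: Ccv => Ccv; apply/convex_setP.
  move=> _ _ t [a [c [Aa Cc <-]]] [a' [c' [Aa' Cc' <-]]] t01.
  exists (t *: a + (1 - t) *: a'), (t *: c + (1 - t) *: c'); split; [exact: Acv|exact: Ccv|].
  by rewrite bmulDl !bmulZl !scalerDr addrACA.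
- move=> x _; split=> //; exists (g x).1, (g x).2; have [? ?] := hg x; by split.
- apply/bounded_setE; exists (MA * `|y| + MC) => _ [x _ <-].
  rewrite /f (le_trans (ler_normD _ _))// lerD// (CM' x)//; by case: (hg x).
(* The [A]-parts along [d] stay relatively weakly compact when multiplied by [y], so only the
   [C]-parts contribute. *)
- move=> d _ db d0; apply: le_lt_trans (Psi_lt _ d0).
  have Cdb : bounded_set (mimage C (range d)) by apply: bounded_setW C_bounded; exact: mimageS.
  apply: le_trans (C_contr _ _ db Cdb) => //.
  apply: le_de_blasi => // e Ce; have [e0 _] := Ce.
  have [||k [ku ck kM]] := weakly_compact_approx_choice (s := fun i => (g (d i)).2) (M := MC) Ce.
  + by move=> i; exists (d i); [exists i|case: (hg (d i))].
  + by move=> i; apply: (CM' (d i)); case: (hg (d i)).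
  apply: de_blasi_le; apply: (@weakly_compact_approx_range _
    (fun i => bmul (g (d i)).1 y + k i) (MA * `|y| + (MC + e))) => // [i|i|].
  + by rewrite /f /= opprD addrACA subrr add0r.
  + by rewrite (le_trans (ler_normD _ _))// lerD.
  apply: ultra_weakly_cvg_range => V VU.
  have [|a aV] :=
    ultra_weakly_cvg_fam (A_ultra db (fun n => (hg (d n)).1)) VU (s := fun n => (g (d n)).1).
    by apply: filterE => n; exists n.
  have [|z kV] := ultra_weakly_cvg_fam ku VU (s := k).
    by apply: filterE => n; exists n.
  by exists (bmul a y + z); apply: weak_limD => //; exact: weak_lim_bmulr.
- move=> x_ z_ x z _ xb zb _ xx Fxz zz.
  have /choice[ac hac] : forall n, exists ac : E * E, [/\ A (x_ n) ac.1, C (x_ n) ac.2 &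
      bmul ac.1 y + ac.2 = z_ n].
    by move=> n; have [a [c acE]] := Fxz n; exists (a, c).
  have [|i_ [a [ioo aa]]] := weak_lim_extract (s := fun n => (ac n).1).
    by apply: (A_ultra xb) => n; case: (hac n).
  have xi := weak_lim_subseq xx ioo; have zi := weak_lim_subseq zz ioo.
  exists a, (z - bmul a y); split; last by rewrite addrC subrK.
    apply: (A_graph _ (iffRL (weak_cvgP _ _) xi) _ _ (iffRL (weak_cvgP _ _) aa)) => // n.
    by case: (hac (i_ n)).
  have ci := weak_limB zi (weak_lim_bmulr (y := y) aa).
  apply: (C_graph _ (iffRL (weak_cvgP _ _) xi) _ _ (iffRL (weak_cvgP _ _) (ci _ _))) => // n /=.
  by have [_ Cc <-] := hac (i_ n); rewrite addrAC subrr add0r.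
Qed.

Lemma mpreimage_quotientP (Y : set E) x : mpreimage (quotient_map A C) Y x <->
  exists y a c, [/\ Y y, A x a, C x c & bmul a y + c = x].
Proof.
split=> [[y [[_ [a Aa [_ -> <-]] [c Cc xE]] Yy]]|[y [a [c [Yy Aa Cc xE]]]]].
  by exists y, a, c.
by exists y; split => //; exists (bmul a y); [exists a => //; exists y|exists c].
Qed.

End Hypotheses.

End FixedPoint.

Theorem theorem4p2 (R : realType) (E : banachAlgType R) (S : set E)
    (A B C : E -> set E) (Phi Psi : R -> R)
    (S_neq0 : S !=set0) (S_closed : closed S) (S_convex : convex_set S)
    (E_P : condition_P E)
    (A_cv : closed_convex_valued setT A)
    (B_cv : closed_convex_valued S B)
    (C_cv : closed_convex_valued setT C)
    (A_graph : weakly_seq_closed_graph setT A)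
    (B_graph : weakly_seq_closed_graph S B)
    (C_graph : weakly_seq_closed_graph setT C)
    (A_wcompact : weakly_compact_map setT A)
    (B_contr : countably_D_set_contraction S B Phi)
    (C_contr : D_set_contraction setT C Psi)
    (A_bounded : bounded_set (mimage A setT))
    (B_bounded : bounded_set (mimage B S))
    (C_bounded : bounded_set (mimage C setT))
    (preim_S : forall u, S u ->
       [/\ closed (mpreimage (quotient_map A C) (B u)),
           convex_set (mpreimage (quotient_map A C) (B u))
         & mpreimage (quotient_map A C) (B u) `<=` S])
    (contr : forall r : R, 0 < r ->
       set_norm (mimage A S) * Phi r + Psi r < r) :
  exists x, S x /\ set_add (set_mul (A x) (B x)) (C x) x.
Proof.
have [[_ _ Phi_le Phi0 _] B_c] := B_contr; have [_ C_c] := C_contr.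
have /bounded_setE[MA AM] := A_bounded; have /bounded_setE[MB BM] := B_bounded.
have /bounded_setE[MC CM] := C_bounded.
have AM' x a : A x a -> `|a| <= MA by move=> Aa; apply: AM; exists x.
have BM' x b : S x -> B x b -> `|b| <= MB by move=> Sx Bb; apply: BM; exists x.
have CM' x c : C x c -> `|c| <= MC by move=> Cc; apply: CM; exists x.
have A_ultra (s a : nat -> E) : bounded_set (range s) -> (forall n, A (s n) (a n)) ->
    ultra_weakly_cvg (range a).
  move=> sb As; have := relatively_weakly_compact_ultra (A_wcompact (range s) (fun _ _ => I) sb).
  by apply: ultra_weakly_cvgW => _ [n _ <-]; exists (s n) => //; exists n.
pose N u := mpreimage (quotient_map A C) (B u).
suff [x Sx /mpreimage_quotientP[y [a [c [By Aa Cc xE]]]]] : exists2 x, S x & N x x.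
  exists x; split=> //; exists (bmul a y); first by exists a => //; exists y.
  by exists c.
(* A point of [N u] with its decomposition: the parts in [A] and [C] are taken at that point, the
   part in [B] at [u]. *)
have /choice[g hg] : forall u, exists xybc : E * E * E * E, S u ->
    [/\ N u xybc.1.1.1, A xybc.1.1.1 xybc.1.1.2, B u xybc.1.2, C xybc.1.1.1 xybc.2 &
        bmul xybc.1.1.2 xybc.1.2 + xybc.2 = xybc.1.1.1].
  move=> u; have [Su|nSu] := pselect (S u); last by exists (0, 0, 0, 0).
  have [[y By] _ _] := B_cv u Su.
  have [x [a [c [Aa Cc xE]]]] := solution_exists A_cv C_cv A_graph C_graph
    A_wcompact A_bounded C_bounded y C_contr.
  exists (x, a, y, c) => _ /=; split => //.
  by apply/mpreimage_quotientP; exists y, a, c.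
pose f u := (g u).1.1.1; pose a u := (g u).1.1.2; pose b u := (g u).1.2; pose c u := (g u).2.
have Sf u : S u -> S (f u).
  by move=> Su; have [_ _] := preim_S u Su; apply; have [] := hg u Su.
apply: (condensing_fixed_point (f := f)) => //.
- by move=> u Su; have [? ? _] := preim_S u Su.
- by move=> u Su; split; [exact: Sf|have [] := hg u Su].
- apply/bounded_setE; exists (MA * MB + MC) => _ [u Su <-].
  have [_ Aa Bb Cc xE] := hg u Su.
  rewrite /f -xE (le_trans (ler_normD _ _))// lerD ?(CM' _ _ Cc)//.
  by rewrite (le_trans (normr_bmul _ _))// ler_pM// ?(AM' _ _ Aa) ?(BM' _ _ Su Bb).
- move=> d dS db; set r := de_blasi (range d); set t := de_blasi (range (f \o d)) => r0.
  have dSi i : S (d i) by apply: dS; exists i.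
  have fdS : range (f \o d) `<=` S by move=> _ [i _ <-]; exact/Sf.
  set al := set_norm (mimage A S) in contr.
  (* The factor [a (d i)] is a value of [A] at [f (d i)], a point of [S], so the norm of [A(S)]
     bounds it. *)
  have a_al i : `|a (d i)| <= al.
    apply: ub_le_sup; last first.
      exists (a (d i)) => //; have [_ Aa _ _ _] := hg _ (dSi i).
      by exists (f (d i)) => //; exact: Sf.
    by exists MA => _ [z [x _ Axz] <-]; exact: AM' Axz.
  have al0 : 0 <= al := le_trans (normr_ge0 _) (a_al 0%N).
  have fdb : bounded_set (range (f \o d)).
    apply/bounded_setE; exists (MA * MB + MC) => _ [i _ <-] /=.
    have [_ Aa Bb Cc xE] := hg _ (dSi i).
    rewrite /f -xE (le_trans (ler_normD _ _))// lerD ?(CM' _ _ Cc)//.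
    by rewrite (le_trans (normr_bmul _ _))// ler_pM// ?(AM' _ _ Aa) ?(BM' _ _ (dSi i) Bb).
  have Bdb : bounded_set (mimage B (range d)) by apply: bounded_setW B_bounded; exact: mimageS.
  have Cfdb : bounded_set (mimage C (range (f \o d))).
    by apply: bounded_setW C_bounded; exact: mimageS.
  have t0 : 0 <= t by exact: de_blasi_ge0.
  (* Approximate the [B]-parts within [e1] and the [C]-parts within [e2] by weakly compact sets: the
     recombined sequence is relatively weakly compact by (P) and within [al * e1 + e2] of
     [f \o d]. *)
  have key : t <= al * de_blasi (mimage B (range d)) + de_blasi (mimage C (range (f \o d))).
    apply/ler_addgt0Pr => e e0.
    have al1 : 0 < al + 1 by rewrite ltr_wpDl.
    (* The slack [h] enters once multiplied by [al] and once alone, for a total of [e]. *)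
    pose h := e / (al + 1); have h0 : 0 < h by rewrite divr_gt0.
    have hE : al * h + h = e by rewrite -[X in _ + X]mul1r -mulrDl mulrC divfK// gt_eqF.
    have [|||k [ku bk kM]] := weakly_compact_approx_choice (s := b \o d) (M := MB)
      (weakly_compact_approx_gt (e := de_blasi (mimage B (range d)) + h) Bdb _).
    + by rewrite ltrDl.
    + by move=> i; exists (d i); [exists i|case: (hg _ (dSi i))].
    + by move=> i; apply: (BM' (d i)) => //; case: (hg _ (dSi i)).
    have [|||l [lu cl lM]] := weakly_compact_approx_choice (s := c \o d) (M := MC)
      (weakly_compact_approx_gt (e := de_blasi (mimage C (range (f \o d))) + h) Cfdb _).
    + by rewrite ltrDl.
    + by move=> i; exists (f (d i)); [exists i|case: (hg _ (dSi i))].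
    + by move=> i; apply: (CM' (f (d i))); case: (hg _ (dSi i)).
    set e1 := _ + h in bk kM; set e2 := _ + h in cl lM.
    have e10 : 0 <= e1 by rewrite addr_ge0 ?de_blasi_ge0 ?(ltW h0).
    have e20 : 0 < e2 by rewrite ltr_wpDl ?de_blasi_ge0.
    have -> : al * de_blasi (mimage B (range d)) + de_blasi (mimage C (range (f \o d))) + e =
       al * e1 + e2 by rewrite -hE /e1 /e2; ring.
    have au : ultra_weakly_cvg (range (a \o d)).
      by apply: (A_ultra _ _ fdb) => i; case: (hg _ (dSi i)).
    have akM i : `|bmul (a (d i)) (k i)| <= al * (MB + e1).
      by rewrite (le_trans (normr_bmul _ _))// ler_pM.
    apply: de_blasi_le; apply: (@weakly_compact_approx_range _ _ _
      (fun i => bmul (a (d i)) (k i) + l i) (al * (MB + e1) + (MC + e2))) => [|i|i|].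
    + by rewrite ltr_wpDl// mulr_ge0.
    + have [_ _ _ _ fE] := hg _ (dSi i).
      rewrite /= /f -fE opprD addrACA -bmulBr (le_trans (ler_normD _ _))// lerD//; last exact: cl.
      rewrite (le_trans (normr_bmul _ _))//.
      by apply: ler_pM => //; [exact: a_al|exact: bk].
    + by rewrite (le_trans (ler_normD _ _))// lerD.
    apply: ultra_weakly_cvg_range => V VU.
    have Vr (s : nat -> E) : V (s @^-1` range s) by apply: filterE => n; exists n.
    have [x ax] := ultra_weakly_cvg_fam au VU (Vr _).
    have [y ky] := ultra_weakly_cvg_fam ku VU (Vr _).
    have [z lz] := ultra_weakly_cvg_fam lu VU (Vr _).
    exists (bmul x y + z); apply: weak_limD => //.
    exact: (ultra_weakly_cvg_bmul E_P akM au ku VU ax ky).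
  have B1 : de_blasi (mimage B (range d)) <= Phi r.
    by apply: B_c => //; exact: countable_range.
  have C1 : de_blasi (mimage C (range (f \o d))) <= Psi t by exact: C_c.
  have key2 : t <= al * Phi r + Psi t.
    by apply: le_trans key _; rewrite lerD// ler_wpM2l.
  rewrite ltNge; apply/negP => rt; have := contr t (lt_le_trans r0 rt).
  rewrite ltNge (le_trans key2)// lerD2r ler_wpM2l//; apply: Phi_le => //.
  exact: ltW.
- move=> u_ x_ u x Su_ ub xb Su uu Nux xx.
  have /choice[h hh] : forall n, exists yac : E * E * E, [/\ B (u_ n) yac.1.1, A (x_ n) yac.1.2,
      C (x_ n) yac.2 & bmul yac.1.2 yac.1.1 + yac.2 = x_ n].
    by move=> n; have /mpreimage_quotientP[y [a' [c' H]]] := Nux n; exists (y, a', c').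
  have Bub : bounded_set (mimage B (range u_)).
    by apply: bounded_setW B_bounded; apply: mimageS => _ [n _ <-].
  (* A weakly convergent [u_] has range of measure 0, and [Phi 0 = 0] transfers this to the
     [B]-parts. *)
  have yu : ultra_weakly_cvg (range (fun n => (h n).1.1)).
    have Bu0 : de_blasi (mimage B (range u_)) <= 0.
      rewrite -Phi0 -(de_blasi_range_ultra ub (weak_lim_range_ultra uu)).
      by apply: B_c => // [_ [n _ <-]|] //; exact: countable_range.
    apply: ultra_weakly_cvgW (de_blasi_ultra Bub Bu0) => _ [n _ <-].
    by apply: subset_closure; exists (u_ n); [exists n|case: (hh n)].
  have [|i_ [a' [ioo aa]]] := weak_lim_extract (s := fun n => (h n).1.2).
    by apply: (A_ultra _ _ xb) => n; case: (hh n).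
  have [|j_ [y [joo yy]]] := weak_lim_extract (s := fun n => (h (i_ n)).1.1).
    by apply: ultra_weakly_cvgW yu => _ [n _ <-]; exists (i_ n).
  have {}aa := weak_lim_subseq aa joo.
  have xi := weak_lim_subseq (weak_lim_subseq xx ioo) joo.
  have ui := weak_lim_subseq (weak_lim_subseq uu ioo) joo.
  have /weak_cvgP ay := E_P _ _ _ _ (iffRL (weak_cvgP _ _) aa) (iffRL (weak_cvgP _ _) yy).
  apply/mpreimage_quotientP; exists y, a', (x - bmul a' y); split.
  + apply: (B_graph _ _ _ _ _ (iffRL (weak_cvgP _ _) ui) Su _ (iffRL (weak_cvgP _ _) yy)) => n //=.
    by case: (hh (i_ (j_ n))).
  + apply: (A_graph _ _ _ _ _ (iffRL (weak_cvgP _ _) xi) I _ (iffRL (weak_cvgP _ _) aa)) => n //=.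
    by case: (hh (i_ (j_ n))).
  + have ci := weak_limB xi ay.
    apply: (C_graph _ _ _ _ _ (iffRL (weak_cvgP _ _) xi) I _
      (iffRL (weak_cvgP _ _) (ci _))) => n //=.
    have [_ _ Cc xE] := hh (i_ (j_ n)).
    by rewrite -[X in C _ (X - _)]xE addrAC subrr add0r.
  + by rewrite addrC subrK.
Qed.
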